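(* Let $(M,D,g)$ be a sub-Riemannian manifold, where $M$ is simply connected and compact and $D$ has rank $k\geq2$. Let $\mathfrak{g}$ be the Lie algebra of a Lie group $G$, with a generating subspace $\mathfrak{e}\subseteq\mathfrak{g}$ of positive codimension. Let $\alpha\in\Omega^1(M,\mathfrak{g})$ be a one-form with $d\alpha+\frac12[\alpha,\alpha]=0$ and satisfying $\alpha(D)\subseteq\mathfrak{e}$. (a) Assume that there exists a non-intersecting horizontal loop $\gamma\colon[0,1]\to M$ such that $\alpha(\dot\gamma(t))=0$ for almost every $t\in[0,1]$. Then $\alpha$ is singular. (b) Assume that $\mathfrak{e}\subseteq\mathfrak{g}$ is strongly $k$-bracket generating. If $\alpha|_D$ is injective at every point, then $\alpha$ is regular.
   Context: A sub-Riemannian manifold $(M,D,g)$ is a connected manifold $M$ with a bracket-generating subbundle $D\subseteq TM$ (sections and their iterated brackets span each tangent space) and a metric tensor $g$ on $D$. A horizontal curve is an absolutely continuous curve $\gamma$ with $\dot\gamma(t)\in D_{\gamma(t)}$ for almost every $t$; a non-intersecting loop is one with $\gamma(0)=\gamma(1)$ and no other self-intersections. A subspace $\mathfrak{e}\subseteq\mathfrak{g}$ is generating if it generates $\mathfrak{g}$ as a Lie algebra. $\Omega^1(M,\mathfrak{g})$ is the space of smooth $\mathfrak{g}$-valued one-forms. For $\alpha,\beta\in\Omega^1(M,\mathfrak{g})$, $[\alpha,\beta](v,w)=[\alpha(v),\beta(w)]-[\alpha(w),\beta(v)]$; for a function $F\in C^\infty(M,\mathfrak{g})$, $[\alpha,F](v)=[\alpha(v),F(x)]$,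 $v\in T_xM$. Strongly bracket generating: $\mathfrak{e}\subset\mathfrak{g}$ is strongly $q$-bracket generating if for any $1\leq l\leq q$, any linearly independent $A_1,\dots,A_l\in\mathfrak{e}$ and any $Z_1,\dots,Z_l\in\mathfrak{g}$, there exists $B\in\mathfrak{e}$ such that $Z_j-[A_j,B]\in\mathfrak{e}$ for $j=1,\dots,l$. Regular and singular: let $\mathcal{A}=\{\alpha\in\Omega^1(M,\mathfrak{g}):d\alpha+\frac12[\alpha,\alpha]=0\}$, whose tangent space at $\alpha$ is $T_\alpha\mathcal{A}=\{dF+[\alpha,F]:F\in C^\infty(M,\mathfrak{g})\}$, and let $P(\alpha)=\alpha|_D\bmod\mathfrak{e}$, a linear map into $\mathfrak{g}/\mathfrak{e}$-valued partial one-forms on $D$. A form $\alpha\in\mathcal{A}$ with $\alpha(D)\subseteq\mathfrak{e}$ is regular if the differential of $P|_{\mathcal{A}}$ at $\alpha$ is surjective, and singular if it is not. Explicitly, $\alpha$ is regular if and only if for every $\psi\in\Omega^1(M,\mathfrak{g})$ there is $F\in C^\infty(M,\mathfrak{g})$ with $$(dF+[\alpha,F])|_D=\psi|_D\mod\mathfrak{e}.$$ *)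

(* Defs.v *)
From mathcomp Require Import all_boot all_order all_algebra.
From mathcomp Require Import all_classical all_reals all_analysis.

Set Implicit Arguments.
Unset Strict Implicit.
Unset Printing Implicit Defensive.

Import Order.TTheory GRing.Theory Num.Theory.
Import numFieldNormedType.Exports.

Local Open Scope classical_set_scope.
Local Open Scope ring_scope.

(* C^r and C^oo functions on an open subset U of a normed space. *)
Section SmoothFunctions.
Context {R : realType} {V W : normedModType R}.

Fixpoint Ck_on (r : nat) (U : set V) (f : V -> W) : Prop :=
  match r with
  | 0 => forall x, U x -> {for x, continuous f}
  | r'.+1 => (forall x, U x -> differentiable f x) /\
             (forall v, Ck_on r' U (fun x => 'D_v f x))
  end.

Definition smooth_on (U : set V) (f : V -> W) : Prop :=
  forall r, Ck_on r U f.

End SmoothFunctions.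

(* The maps are total; [chart_map] is meaningful on [chart_dom] only, and
   [chart_inv] on [chart_cod] only. *)
Record chart (R : realType) (n : nat) (M : topologicalType) := Chart {
  chart_dom : set M;
  chart_map : M -> 'rV[R]_n;
  chart_inv : 'rV[R]_n -> M }.

Definition chart_cod (R : realType) n (M : topologicalType)
  (c : chart R n M) : set 'rV[R]_n := chart_map c @` chart_dom c.

Record is_chart (R : realType) n (M : topologicalType) (c : chart R n M) :
  Prop := IsChart {
  chart_dom_open : open (chart_dom c);
  chart_cod_open : open (chart_cod c);
  chart_mapK : forall x, chart_dom c x -> chart_inv c (chart_map c x) = x;
  chart_map_continuous :
    forall x, chart_dom c x -> {for x, continuous (chart_map c)};
  chart_inv_continuous :
    forall y, chart_cod c y -> {for y, continuous (chart_inv c)} }.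

Record manifold (R : realType) (n : nat) := Manifold {
  manifold_space :> topologicalType;
  atlas : set (chart R n manifold_space);
  manifold_hausdorff : hausdorff_space manifold_space;
  manifold_second_countable : @second_countable manifold_space;
  atlas_chart : forall c, atlas c -> is_chart c;
  atlas_cover : forall x, exists2 c, atlas c & chart_dom c x;
  atlas_smooth : forall c d, atlas c -> atlas d ->
    smooth_on (chart_map c @` (chart_dom c `&` chart_dom d))
      (fun y => chart_map d (chart_inv c y)) }.

Definition simply_connected (R : realType) (M : topologicalType) : Prop :=
  (forall x y : M, exists p : R -> M,
     [/\ {within `[0, 1], continuous p}, p 0 = x & p 1 = y]) /\
  (forall p : R -> M, {within `[0, 1], continuous p} -> p 0 = p 1 ->
     exists H : R * R -> M,
       [/\ {within `[0, 1] `*` `[0, 1], continuous H},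
           forall t, t \in `[0, 1] -> H (0, t) = p t,
           forall t, t \in `[0, 1] -> H (1, t) = p 0 &
           forall s, s \in `[0, 1] -> H (s, 0) = p 0 /\ H (s, 1) = p 0]).

Section TangentVectors.
Context {R : realType} {n : nat} (M : manifold R n).

Definition smooth_fun (f : M -> R) : Prop :=
  forall c, atlas c -> smooth_on (chart_cod c) (fun y => f (chart_inv c y)).

Definition tvec := (M -> R) -> R.
Definition vfield := M -> tvec.

(* T_x M is the space of derivations at x of the algebra of smooth functions.
   A derivation is extended by 0 to the non-smooth functions, so that two
   tangent vectors are equal iff they agree on the smooth functions. *)
Record tangent (x : M) (v : tvec) : Prop := Tangent {
  tangent_junk : forall f, ~ smooth_fun f -> v f = 0;
  tangent_linear : forall (a : R) f h, smooth_fun f -> smooth_fun h ->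
    v (fun y => a * f y + h y) = a * v f + v h;
  tangent_leibniz : forall f h, smooth_fun f -> smooth_fun h ->
    v (fun y => f y * h y) = v f * h x + f x * v h }.

Definition lincomb (m : nat) (a : 'I_m -> R) (v : 'I_m -> tvec) : tvec :=
  fun f => \sum_(i < m) a i * v i f.

Definition smooth_vfield (X : vfield) : Prop :=
  (forall x, tangent x (X x)) /\
  (forall f, smooth_fun f -> smooth_fun (fun x => X x f)).

Definition vbracket (X Y : vfield) : vfield :=
  fun x f => X x (fun y => Y y f) - Y x (fun y => X y f).

End TangentVectors.

Section SubRiemannian.
Context {R : realType} {n : nat} {M : manifold R n}.

(* D is a smooth subbundle of rank k: near each point it has a smooth frame.
   Frames are restrictions of global vector fields, which is no loss since a
   local section agrees with a global one on a smaller neighbourhood. *)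
Definition subbundle (k : nat) (D : M -> set (tvec M)) : Prop :=
  forall x, exists2 U : set M, open_nbhs x U &
  exists2 X : 'I_k -> vfield M, (forall i, smooth_vfield (X i)) &
  forall y, U y ->
    (forall a, lincomb a (fun i => X i y) = (fun=> 0) -> forall i, a i = 0) /\
    (forall v, D y v <-> exists a, v = lincomb a (fun i => X i y)).

Definition section_of (D : M -> set (tvec M)) (X : vfield M) : Prop :=
  smooth_vfield X /\ forall x, D x (X x).

Inductive iterated_bracket (D : M -> set (tvec M)) : vfield M -> Prop :=
| IB_section X : section_of D X -> iterated_bracket D X
| IB_bracket X Y : iterated_bracket D X -> iterated_bracket D Y ->
    iterated_bracket D (vbracket X Y).

Definition bracket_generating (D : M -> set (tvec M)) : Prop :=
  forall x v, tangent x v ->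
  exists m (a : 'I_m -> R) (X : 'I_m -> vfield M),
    (forall i, iterated_bracket D (X i)) /\ v = lincomb a (fun i => X i x).

Record metric_tensor (D : M -> set (tvec M))
  (q : M -> tvec M -> tvec M -> R) : Prop := MetricTensor {
  metric_sym : forall x u v, D x u -> D x v -> q x u v = q x v u;
  metric_linear : forall x (a : R) u v w, D x u -> D x v -> D x w ->
    q x (fun f => a * u f + v f) w = a * q x u w + q x v w;
  metric_pos : forall x v, D x v -> v <> (fun=> 0) -> 0 < q x v v;
  metric_smooth : forall X Y, section_of D X -> section_of D Y ->
    smooth_fun (fun x => q x (X x) (Y x)) }.

Record sub_riemannian (k : nat) (D : M -> set (tvec M))
  (q : M -> tvec M -> tvec M -> R) : Prop := SubRiemannian {
  subriem_connected : connected [set: M];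
  subriem_subbundle : subbundle k D;
  subriem_bracket_generating : bracket_generating D;
  subriem_metric : metric_tensor D q }.

End SubRiemannian.

Section Curves.
Context {R : realType}.

Definition abs_continuous (V : normedModType R) (a b : R) (f : R -> V) : Prop :=
  forall e : R, 0 < e -> exists2 d : R, 0 < d &
  forall m (s t : 'I_m -> R),
    (forall i, [/\ a <= s i, s i <= t i & t i <= b]) ->
    (forall i j, i != j -> t i <= s j \/ t j <= s i) ->
    \sum_(i < m) (t i - s i) < d ->
    \sum_(i < m) `|f (t i) - f (s i)| < e.

Context {n : nat} {M : manifold R n}.

Definition abs_continuous_curve (p : R -> M) : Prop :=
  {within `[0, 1], continuous p} /\
  forall c a b, atlas c -> 0 <= a -> b <= 1 ->
    (forall t, t \in `[a, b] -> chart_dom c (p t)) ->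
    abs_continuous a b (fun t => chart_map c (p t)).

Definition velocity (p : R -> M) (t : R) (v : tvec M) : Prop :=
  tangent (p t) v /\
  forall f, smooth_fun f -> is_derive t (1 : R) (fun s => f (p s)) (v f).

(* A curve on [0, 1] is a total map; its values outside [0, 1] affect the
   velocity at the endpoints only, which are negligible. *)
Definition horizontal (D : M -> set (tvec M)) (p : R -> M) : Prop :=
  abs_continuous_curve p /\
  {ae @lebesgue_measure R, forall t, t \in `[0, 1] ->
     exists2 v, velocity p t v & D (p t) v}.

Definition non_intersecting_loop (p : R -> M) : Prop :=
  p 0 = p 1 /\
  forall s t, s \in `[0, 1[ -> t \in `[0, 1[ -> p s = p t -> s = t.

End Curves.

Record lieAlgebra (R : realType) := LieAlgebra {
  lie_space :> vectType R;
  lie_br : lie_space -> lie_space -> lie_space;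
  lie_br_linearl : forall a x y z,
    lie_br (a *: x + y) z = a *: lie_br x z + lie_br y z;
  lie_br_linearr : forall a x y z,
    lie_br x (a *: y + z) = a *: lie_br x y + lie_br x z;
  lie_brxx : forall x, lie_br x x = 0;
  lie_br_jacobi : forall x y z,
    lie_br x (lie_br y z) + lie_br y (lie_br z x) + lie_br z (lie_br x y) = 0 }.

Section LieSubspaces.
Context {R : realType} {g : lieAlgebra R}.
Local Notation "[[ x , y ]]" := (@lie_br R g x y) (at level 0).

Definition lie_generating (e : {vspace g}) : Prop :=
  forall h : {vspace g}, (e <= h)%VS ->
    (forall x y, x \in h -> y \in h -> [[x, y]] \in h) -> h = fullv.

Definition strongly_bracket_generating (q : nat) (e : {vspace g}) : Prop :=
  forall l, (1 <= l <= q)%N ->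
  forall A Z : l.-tuple g, free A -> (forall j, tnth A j \in e) ->
  exists2 B, B \in e & forall j, tnth Z j - [[tnth A j, B]] \in e.

End LieSubspaces.

Section Forms.
Context {R : realType} {n : nat} {M : manifold R n} {g : lieAlgebra R}.
Local Notation "[[ x , y ]]" := (@lie_br R g x y) (at level 0).

(* Coordinates in a basis of g; none of the notions below depends on it. *)
Definition lie_coord (i : 'I_(\dim {:g})) (x : g) : R :=
  coord (vbasis {:g}) i x.

Definition smooth_gfun (F : M -> g) : Prop :=
  forall i, smooth_fun (fun x => lie_coord i (F x)).

(* The derivative dF(v) of a g-valued function along a tangent vector. *)
Definition gderiv (F : M -> g) (v : tvec M) : g :=
  \sum_i v (fun x => lie_coord i (F x)) *: (vbasis {:g})`_i.

(* Only the values of a form on tangent vectors are meaningful. *)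
Definition gform := M -> tvec M -> g.

Definition one_form (alpha : gform) : Prop :=
  (forall x (a : R) u v, tangent x u -> tangent x v ->
     alpha x (fun f => a * u f + v f) = a *: alpha x u + alpha x v) /\
  (forall X, smooth_vfield X -> smooth_gfun (fun x => alpha x (X x))).

Definition ext_deriv (alpha : gform) (X Y : vfield M) (x : M) : g :=
  gderiv (fun y => alpha y (Y y)) (X x) - gderiv (fun y => alpha y (X y)) (Y x)
  - alpha x (vbracket X Y x).

Definition form_bracket (alpha beta : gform) (x : M) (v w : tvec M) : g :=
  [[alpha x v, beta x w]] - [[alpha x w, beta x v]].

(* The set A of the forms with d alpha + (1/2) [alpha, alpha] = 0. *)
Definition flat_form (alpha : gform) : Prop :=
  one_form alpha /\
  forall X Y, smooth_vfield X -> smooth_vfield Y -> forall x,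
    ext_deriv alpha X Y x
      + 2%:R^-1 *: form_bracket alpha alpha x (X x) (Y x) = 0.

(* The tangent space of A at alpha: the forms dF + [alpha, F]. *)
Definition flat_tangent (alpha beta : gform) : Prop :=
  exists2 F : M -> g, smooth_gfun F &
  beta = fun x v => gderiv F v + [[alpha x v, F x]].

(* P beta = P psi, where P maps a form to its restriction to D modulo e. *)
Definition eq_on_mod (D : M -> set (tvec M)) (e : {vspace g})
  (beta psi : gform) : Prop :=
  forall x v, D x v -> beta x v - psi x v \in e.

Definition form_in (D : M -> set (tvec M)) (e : {vspace g}) (alpha : gform) :
  Prop := forall x v, D x v -> alpha x v \in e.

(* P is linear, so the differential of its restriction to A is its restriction
   to the tangent space of A. The forms psi on M account for the whole target,
   since every g/e-valued partial form on D is P psi for some psi. *)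
Definition regular_form (D : M -> set (tvec M)) (e : {vspace g}) (alpha : gform) :
  Prop :=
  forall psi, one_form psi ->
  exists2 beta, flat_tangent alpha beta & eq_on_mod D e beta psi.

Definition singular_form (D : M -> set (tvec M)) (e : {vspace g}) (alpha : gform) :
  Prop := ~ regular_form D e alpha.

Definition form_injective_on (D : M -> set (tvec M)) (alpha : gform) : Prop :=
  forall x u v, D x u -> D x v -> alpha x u = alpha x v -> u = v.

End Forms.

Arguments gform {R n} M g.

(* Main.v *)
Require Import Defs.
From mathcomp Require Import all_boot all_order all_algebra finmap.
From mathcomp Require Import all_classical all_reals all_analysis.
From mathcomp Require Import ring lra.
From HB Require Import structures.
Import Order.TTheory GRing.Theory Num.Theory.
Import numFieldNormedType.Exports.
Local Open Scope classical_set_scope.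
Local Open Scope ring_scope.

(** Why the theorem is true.

    (a) Fix a linear functional lam on g that vanishes on e and a vector z with
    lam z = 1. If alpha were regular, then for all smooth functions h and f the
    form psi = h df z would agree modulo e, on D, with some dF + [alpha, F].
    Along the loop p the bracket term vanishes, because alpha(p') = 0 almost
    everywhere, so the real function u = lam(F(p)) satisfies
    u' = h(p) (f(p))' almost everywhere. It is absolutely continuous, and
    u(0) = u(1) because p is closed; hence the integral of h df over the loop
    would vanish for all h and f. As p has no other self-intersection, h can be
    chosen equal to 1 on the arc p([1/3, 2/3]) and to 0 on the rest of the loop
    up to two short arcs ([smooth_urysohn]). Then the integral differs from
    f(p(2/3)) - f(p(1/3)) by at most the variation of f(p) on the short arcs,
    which absolute continuity makes as small as desired; a function f that
    separates p(1/3) from p(2/3) gives a contradiction.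

    No integral is formed. What takes its place, for absolutely continuous
    functions, is [abs_continuous_growth]: if |u'| <= |phi'| almost everywhere,
    then the increment of u is bounded by the variation of phi. It is proved as
    in the theory of the gauge integral: each point has a neighbourhood in
    which either the derivatives control the increments or the intervals stay
    inside an open set of small measure, and [cousin] adds up such local
    estimates. Taking phi = 0 it also says that u' = 0 forces u to be constant.

    (b) It suffices to look for F with values in e, because then dF takes
    values in e and the equation to solve is [alpha(v), F] = psi(v) modulo e
    for v in D, which contains no derivative of F. In a frame X_1, ..., X_k of
    D it is a linear system for the coordinates of F. At a given point the
    vectors alpha(X_i) are linearly independent elements of e, so strong
    k-bracket generation, with l = k, says that the system can be solved for every
    right-hand side. If T(x) is its matrix, acting on row vectors, there is thus
    a matrix S with S T(x0) = 1. The matrix N(x) = S T(x) is square with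
    N(x0) = 1, and its adjugate solves the system multiplied by det N, with
    smooth coefficients and without division ([local_solution]). Solutions
    of the equation multiplied by a nonnegative function s can be added up; by
    compactness finitely many of them have a sum with s > 0 everywhere, and
    dividing by s gives F ([regular_of_strongly_generating]).

    Both parts need smooth bump functions, hence the section on exp(-1/t) and
    the closure properties of C^r functions. *)

Set Implicit Arguments.
Unset Strict Implicit.
Unset Printing Implicit Defensive.

(** * Calculus of C^r functions *)

Section CkCalculus.
Context {R : realType} {V : normedModType R}.
Implicit Types (U : set V) (x : V).

(** h - f vanishes near x, so it is differentiable at x with differential 0. *)
Lemma near_eq_differentiable (W : normedModType R) (f h : V -> W) x :
  (\near x, f x = h x) -> differentiable f x -> differentiable h x.
Proof.
move=> fh df; pose k := h - f.
have k0 : \forall y \near x, k y = 0.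
  by near=> y; rewrite /k !fctE (near fh y)// subrr.
have dk : k \o shift x = cst (k x) + (\0 : {linear V -> W}) +o_ 0 id.
  apply/eqaddoP => /= eps eps0.
  rewrite (nbhs_singleton k0).
  have : \forall y \near (0 : V), k (y + x) = 0.
    by move: k0; rewrite (near_shift 0 x) subr0.
  apply: filterS => y /= ky.
  by rewrite !fctE /= ky addr0 subr0 normr0 mulr_ge0// ltW.
have -> : h = f + k by apply/funext => y; rewrite /k !fctE addrC subrK.
apply: differentiableD => //; apply/diff_locallyP.
have c0 : continuous (\0 : {linear V -> W}) by exact: cst_continuous.
by rewrite (diff_unique c0 dk).
Unshelve. all: by end_near. Qed.

Lemma near_eq_continuous (W : normedModType R) (f h : V -> W) x :
  (\near x, f x = h x) -> {for x, continuous f} -> {for x, continuous h}.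
Proof.
move=> fh cf; rewrite /prop_for /continuous_at -(nbhs_singleton fh).
apply: cvg_trans cf; apply: near_eq_cvg.
by apply: filterS fh => y ->.
Qed.

(** Continuity, differentiability and directional derivatives at a point depend
    on the germ only. This is what allows a function on a manifold to be
    checked with a different formula near each point, and derivatives to be
    computed on an open set alone. *)
Lemma Ck_on_local (W : normedModType R) r U (f : V -> W) :
  (forall x, U x -> exists A h, [/\ open A, A x, Ck_on r A h &
     forall y, A y -> f y = h y]) -> Ck_on r U f.
Proof.
elim: r U f => [|r IH] U f H /=.
  move=> x /H[A [h [Ao Ax Ch fh]]].
  apply: near_eq_continuous (Ch _ Ax).
  by near do rewrite fh//; apply: open_nbhs_nbhs.
split=> [x /H[A [h [Ao Ax [Ch _] fh]]]|v].
  apply: near_eq_differentiable (Ch _ Ax).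
  by near do rewrite fh//; apply: open_nbhs_nbhs.
apply: IH => x /H[A [h [Ao Ax [_ Ch] fh]]].
exists A, (fun x => 'D_v h x); split=> // [|y Ay]; first exact: Ch.
apply: near_eq_derive.
by near do rewrite fh//; apply: open_nbhs_nbhs.
Unshelve. all: by end_near. Qed.

Lemma Ck_on_eq (W : normedModType R) r U (f h : V -> W) : open U ->
  (forall x, U x -> f x = h x) -> Ck_on r U h -> Ck_on r U f.
Proof. by move=> Uo fh Ch; apply: Ck_on_local => x Ux; exists U, h. Qed.

Lemma Ck_on_sub (W : normedModType R) r U U' (f : V -> W) :
  U `<=` U' -> Ck_on r U' f -> Ck_on r U f.
Proof.
elim: r f => [|r IH] f UU' /=; first by move=> Cf x /UU'/Cf.
by case=> df Df; split=> [x /UU'/df//|v]; apply: IH.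
Qed.

Lemma Ck_on_continuous (W : normedModType R) r U (f : V -> W) :
  Ck_on r U f -> forall x, U x -> {for x, continuous f}.
Proof.
by case: r => [//|r] /= [df _] x /df; exact: differentiable_continuous.
Qed.

Lemma Ck_onW (W : normedModType R) r U (f : V -> W) :
  Ck_on r.+1 U f -> Ck_on r U f.
Proof.
elim: r f => [|r IH] f; first by move/Ck_on_continuous.
by case=> df Df; split=> // v; apply: IH; exact: Df.
Qed.

Lemma Ck_on_cst (W : normedModType R) r U (a : W) : Ck_on r U (cst a).
Proof.
elim: r a => [|r IH] a /=; first by move=> x _; exact: cst_continuous.
split=> [x _|v]; first exact: differentiable_cst.
by under eq_fun do rewrite derive_cst; exact: IH.
Qed.

Section Scalar.
Implicit Types f h : V -> R.

Lemma Ck_onD r U f h : open U -> Ck_on r U f -> Ck_on r U h ->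
  Ck_on r U (fun x => f x + h x).
Proof.
move=> Uo; elim: r f h => [|r IH] f h /=.
  by move=> cf ch x Ux; apply: continuousD; [exact: cf|exact: ch].
move=> [df Df] [dh Dh]; split=> [x Ux|v].
  by apply: differentiableD; [exact: df|exact: dh].
apply: (@Ck_on_eq _ _ _ _ (fun x => 'D_v f x + 'D_v h x)) => // [x Ux|].
  by apply: deriveD; apply: diff_derivable; [exact: df|exact: dh].
exact: IH.
Qed.

Lemma Ck_onM r U f h : open U -> Ck_on r U f -> Ck_on r U h ->
  Ck_on r U (fun x => f x * h x).
Proof.
move=> Uo; elim: r f h => [|r IH] f h.
  by move=> cf ch x Ux; apply: continuousM; [exact: cf|exact: ch].
move=> Cf Ch; have [df Df] := Cf; have [dh Dh] := Ch; split=> [x Ux|v].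
  by apply: differentiableM; [exact: df|exact: dh].
apply: (@Ck_on_eq _ _ _ _ (fun x => f x * 'D_v h x + h x * 'D_v f x)) => //.
  by move=> x Ux; apply: deriveM; apply: diff_derivable; [exact: df|exact: dh].
by apply: Ck_onD => //; apply: IH; solve[exact: Ck_onW Cf|exact: Ck_onW Ch|
  exact: Df|exact: Dh].
Qed.

Lemma Ck_onV r U f : open U -> (forall x, U x -> f x != 0) -> Ck_on r U f ->
  Ck_on r U (fun x => (f x)^-1).
Proof.
move=> Uo f0; elim: r => [|r IH].
  by move=> cf x Ux; apply: continuousV; [exact: f0|exact: cf].
move=> Cf; have [df Df] := Cf; split=> [x Ux|v].
  by apply: differentiableV; [exact: df|exact: f0].
apply: (@Ck_on_eq _ _ _ _
  (fun x => (-1) * (((f x)^-1 * (f x)^-1) * 'D_v f x))) => //.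
  move=> x Ux; rewrite (deriveV (f0 _ Ux)); last by apply: diff_derivable; exact: df.
  by rewrite -expr2 exprVn mulN1r scaleNr.
have Cv := IH (Ck_onW Cf).
apply: Ck_onM => //; first exact: Ck_on_cst.
by apply: Ck_onM => //; [exact: Ck_onM|exact: Df].
Qed.

(** The derivative of G i o f in direction v is a combination of the G j o f,
    multiplied by the derivative of f, so one induction on r treats the whole
    family at once; no single member would give an induction hypothesis that
    covers its derivative. *)
Lemma Ck_on_comp (I : Type) (G : I -> R -> R) (dG : I -> R -> R) :
  (forall i t, is_derive t (1 : R) (G i) (dG i t)) ->
  (forall i, exists (m : nat) (a : 'I_m -> R) (s : 'I_m -> I),
     forall t, dG i t = \sum_j a j * G (s j) t) ->
  forall r U f i, open U -> Ck_on r U f -> Ck_on r U (fun x => G i (f x)).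
Proof.
move=> GdG dGG r U f + Uo; elim: r => [|r IH] i.
  move=> cf x Ux; apply: continuous_comp; first exact: cf.
  apply: differentiable_continuous; apply/derivable1_diffP.
  exact: ex_derive.
move=> Cf; have [df Df] := Cf.
have dG1 x : differentiable (G i) (f x).
  by apply/derivable1_diffP; apply: ex_derive.
split=> [x Ux|v]; first by apply: differentiable_comp; [exact: df|exact: dG1].
have [m [a [s dGE]]] := dGG i.
apply: (@Ck_on_eq _ _ _ _
  (fun x => (\sum_j a j * G (s j) (f x)) * 'D_v f x)) => //.
  move=> x Ux; rewrite deriveE; last first.
    by apply: differentiable_comp; [exact: df|exact: dG1].
  rewrite diff_comp; [|exact: df|exact: dG1].
  rewrite /= deriv1E; last by apply: ex_derive.
  rewrite derive1E derive_val dGE deriveE; last exact: df.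
  by rewrite -[LHS]/(_ * _) mulrC.
apply: Ck_onM => //; last exact: Df.
elim: m a s {dGE} => [|m IHm] a s.
  by under eq_fun do rewrite big_ord0; exact: Ck_on_cst.
under eq_fun do rewrite big_ord_recr /=.
apply: Ck_onD => //.
by apply: Ck_onM => //; [exact: Ck_on_cst|apply: IH; exact: Ck_onW].
Qed.

End Scalar.

Lemma Ck_on_coord n r U (f : V -> 'rV[R]_n) (i : 'I_n) : open U -> Ck_on r U f ->
  Ck_on r U (fun x => f x 0 i).
Proof.
move=> Uo; elim: r f => [|r IH] f.
  move=> cf x Ux; apply: (@continuous_comp _ _ _ f (fun M => M 0 i)).
    exact: cf.
  exact: coord_continuous.
case=> df Df; split=> [x Ux|v].
  apply: (@differentiable_comp _ _ _ _ f (fun M => M 0 i)); first exact: df.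
  exact: differentiable_coord.
apply: (@Ck_on_eq _ _ _ _ (fun x => ('D_v f x) 0 i)) => //; last first.
  by apply: IH; exact: Df.
move=> x Ux; rewrite derive_mx ?mxE//.
by apply: diff_derivable; exact: df.
Qed.

End CkCalculus.

(** * A flat function on the line *)

Section Flat.
Context {R : realType}.

(** The function t^(-m) exp(-1/t), extended by 0 to t <= 0. Only m = 0 is used
    to build bump functions; the other exponents appear in its derivatives. *)
Definition flat (m : nat) (t : R) : R :=
  if 0 < t then t^-1 ^+ m * expR (- t^-1) else 0.

Lemma flat_ge0 m t : 0 <= flat m t.
Proof.
rewrite /flat; case: ifP => // t0.
by rewrite mulr_ge0 ?expR_ge0 ?exprn_ge0 ?invr_ge0 ?ltW.
Qed.

Lemma flat0_gt0 t : 0 < t -> 0 < flat 0 t.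
Proof. by move=> t0; rewrite /flat t0 mul1r expR_gt0. Qed.

Lemma flat_le0 m t : t <= 0 -> flat m t = 0.
Proof. by rewrite /flat ltNge => ->. Qed.

(** With y = 1/t this says that y^(m+2) exp(-y) is bounded; the bound
    (m+2)^(m+2) comes from exp(y) = exp(y/k)^k >= (y/k)^k with k = m+2. The
    quadratic decay is what makes the derivative at 0 vanish. *)
Lemma flat_bound m : exists2 C : R, 0 < C & forall t, flat m t <= C * t ^+ 2.
Proof.
pose k : R := m.+2%:R; have k0 : 0 < k by rewrite ltr0n.
have kE : k = m.+2%:R by []; clearbody k.
exists (k ^+ m.+2) => [|t]; first exact: exprn_gt0.
rewrite /flat; case: ifPn => [t0|_]; last first.
  by rewrite mulr_ge0 ?sqr_ge0// exprn_ge0// ltW.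
have y0 : 0 < t^-1 by rewrite invr_gt0.
set y := t^-1 in y0 *.
have ey : (y / k) ^+ m.+2 <= expR y.
  have -> : expR y = expR (y / k) ^+ m.+2.
    by rewrite -expRM_natl -kE mulrC divfK// lt0r_neq0.
  apply: lerXn2r; rewrite ?nnegrE ?expR_ge0 ?divr_ge0 ?ltW//.
  by apply: lt_le_trans (expR_ge1Dx _); rewrite ltrDr.
rewrite expRN ler_pdivrMr ?expR_gt0//.
have -> : t = y^-1 by rewrite invrK.
apply: (@le_trans _ _ (k ^+ m.+2 * y^-1 ^+ 2 * (y / k) ^+ m.+2)).
  rewrite le_eqVlt; apply/orP; left; apply/eqP.
  rewrite -[in RHS]addn2 !exprD expr_div_n exprVn.
  by field; rewrite ?expf_neq0 ?lt0r_neq0.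
by apply: ler_wpM2l => //; rewrite mulr_ge0 ?exprn_ge0 ?invr_ge0 ?ltW.
Qed.

Lemma is_derive_flat m (t : R) :
  is_derive t (1 : R) (flat m) (flat m.+2 t - m%:R * flat m.+1 t).
Proof.
have [t0|t0|->] := ltgtP t 0.
- rewrite !flat_le0 ?ltW// mulr0 subr0.
  apply: (@near_eq_is_derive _ _ _ (cst 0)).
  near=> s; rewrite flat_le0//.
  by near: s; exact: lt_le_nbhsl.
- pose G := (fun s : R => s^-1 ^+ m * expR (- s^-1)).
  have -> : flat m.+2 t - m%:R * flat m.+1 t =
    (- (m%:R * t^-1 ^+ m.+1) + t^-1 ^+ m.+2) * expR (- t^-1).
    by rewrite /flat t0; ring.
  apply: (@near_eq_is_derive _ _ _ G).
    near=> s; rewrite /flat ifT//; near: s; exact: lt_nbhsr.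
  have dV : is_derive t (1 : R) (fun s : R => s^-1) (- t^-1 ^+ 2).
    have := @is_deriveV R id t 1 1 (lt0r_neq0 t0) _.
    by rewrite -exprVn /= /GRing.scale /= mulr1; apply.
  have dX := is_deriveX m dV.
  have dE : is_derive t (1 : R) (fun s : R => expR (- s^-1)) (expR (- t^-1) * t^-1 ^+ 2).
    have dN := @is_deriveN _ _ _ _ _ _ _ dV.
    have := @is_derive1_comp _ expR (fun s : R => - s^-1) t _ _ _ dN.
    rewrite opprK; apply.
  have -> : G = (fun s : R => s^-1) ^+ m * (fun s : R => expR (- s^-1)).
    by apply/funext => s; rewrite !fctE.
  apply: (is_derive_eq (is_deriveM dX dE)).
  rewrite fctE /GRing.scale /=; move: (expR _) => E.
  by case: (m) => [|k] /=; rewrite ?exprS; ring.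
rewrite !flat_le0// mulr0 subr0.
have [C C0 HC] := flat_bound m.
have H : (fun h : R => h^-1 *: ((flat m \o shift 0) (h *: (1 : R)) - flat m 0))
    @ 0^' --> (0 : R).
  apply/cvgrPdist_le => eps eps0.
  have e1 : 0 < eps / C by rewrite divr_gt0.
  near=> h.
  have h0 : h != 0 by near: h; exact: nbhs_dnbhs_neq.
  have hs : `|h| <= eps / C.
    by near: h; exact: dnbhs0_le.
  rewrite sub0r normrN /= addr0 (flat_le0 m (lexx 0)) subr0 /GRing.scale /= mulr1.
  rewrite normrM normfV ler_pdivrMl ?normr_gt0// ger0_norm ?flat_ge0//.
  apply: le_trans (HC _) _; rewrite -(ger0_norm (sqr_ge0 h)) normrX expr2 mulrA.
  rewrite mulrC ler_wpM2l// mulrC -ler_pdivlMr//.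
apply: DeriveDef; first by apply/cvg_ex; exists 0.
exact: cvg_lim H.
Unshelve. all: by end_near. Qed.

Lemma Ck_on_flat (V : normedModType R) r (U : set V) m (f : V -> R) :
  open U -> Ck_on r U f -> Ck_on r U (fun x => flat m (f x)).
Proof.
apply: (@Ck_on_comp _ _ _ flat _ is_derive_flat) => k.
exists 2%N, (fun j => [:: 1; - k%:R]`_j), (fun j => nth 0%N [:: k.+2; k.+1] j) => t.
by rewrite big_ord_recl big_ord1 /= mul1r mulNr.
Qed.

End Flat.

(** * Smooth functions on a manifold *)

Section SmoothFunctions.
Context {R : realType} {n : nat} {M : manifold R n}.
Implicit Types (f h : M -> R) (c : chart R n M).

Lemma chart_codP c y : atlas c -> chart_cod c y ->
  chart_dom c (chart_inv c y) /\ chart_map c (chart_inv c y) = y.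
Proof.
by move=> /atlas_chart cC [x xc <-]; rewrite (chart_mapK cC xc).
Qed.

Lemma open_chart_cod_preimage c (O : set M) : atlas c -> open O ->
  open (chart_cod c `&` chart_inv c @^-1` O).
Proof.
move=> /atlas_chart cC Oo; rewrite openE => y [yc Oy].
apply: filterI; first by apply: open_nbhs_nbhs; split=> //; exact: chart_cod_open.
by apply: (chart_inv_continuous cC yc); exact: open_nbhs_nbhs.
Qed.

Lemma smooth_fun_cst (a : R) : smooth_fun (cst a : M -> R).
Proof. by move=> c _ r; exact: Ck_on_cst. Qed.

Lemma smooth_funD f h : smooth_fun f -> smooth_fun h ->
  smooth_fun (fun x => f x + h x).
Proof.
move=> sf sh c ac r; apply: Ck_onD; [|exact: sf|exact: sh].
exact: chart_cod_open (atlas_chart ac).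
Qed.

Lemma smooth_funM f h : smooth_fun f -> smooth_fun h ->
  smooth_fun (fun x => f x * h x).
Proof.
move=> sf sh c ac r; apply: Ck_onM; [|exact: sf|exact: sh].
exact: chart_cod_open (atlas_chart ac).
Qed.

Lemma smooth_funZ a f : smooth_fun f -> smooth_fun (fun x => a * f x).
Proof. by move=> sf; apply: smooth_funM => //; exact: smooth_fun_cst. Qed.

Lemma smooth_funV f : (forall x, f x != 0) -> smooth_fun f ->
  smooth_fun (fun x => (f x)^-1).
Proof.
move=> f0 sf c ac r; apply: Ck_onV => //; last exact: sf.
exact: chart_cod_open (atlas_chart ac).
Qed.

Lemma smooth_fun_sum (I : Type) (s : seq I) (P : pred I) (F : I -> M -> R) :
  (forall i, smooth_fun (F i)) -> smooth_fun (fun x => \sum_(i <- s | P i) F i x).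
Proof.
move=> sF; elim: s => [|i s IH].
  by under eq_fun do rewrite big_nil; exact: smooth_fun_cst.
under eq_fun do rewrite big_cons; case: (P i) => //.
exact: smooth_funD (sF i) IH.
Qed.

Lemma smooth_fun_prod (I : Type) (s : seq I) (P : pred I) (F : I -> M -> R) :
  (forall i, smooth_fun (F i)) -> smooth_fun (fun x => \prod_(i <- s | P i) F i x).
Proof.
move=> sF; elim: s => [|i s IH].
  by under eq_fun do rewrite big_nil; exact: smooth_fun_cst.
under eq_fun do rewrite big_cons; case: (P i) => //.
exact: smooth_funM (sF i) IH.
Qed.

Lemma smooth_fun_continuous f : smooth_fun f -> continuous f.
Proof.
move=> sf x; have [c ac xc] := atlas_cover x; have cC := atlas_chart ac.
have fc : {for chart_map c x, continuous (fun y => f (chart_inv c y))}.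
  by apply: (sf _ ac 0%N); exists x.
have fm : {for x, continuous (fun z => f (chart_inv c (chart_map c z)))}.
  apply: (@continuous_comp _ _ _ (chart_map c) (fun y => f (chart_inv c y))) => //.
  exact: chart_map_continuous.
move: fm; rewrite /prop_for /continuous_at (chart_mapK cC xc).
apply: cvg_trans; apply: near_eq_cvg.
have : nbhs x (chart_dom c) by apply: open_nbhs_nbhs; split=> //; exact: chart_dom_open cC.
by apply: filterS => z zc; rewrite (chart_mapK cC zc).
Qed.

(** In a chart, a product of the functions flat 0 of (e/2)^2 - (y_i - y0_i)^2 is
    positive exactly in the open box of radius e/2. Extended by 0 outside the
    chart domain it remains smooth: its support is the image of the closed box,
    which is compact, hence closed as M is Hausdorff, so near a point outside
    the chart domain the function is identically 0. *)
Lemma smooth_bump (x0 : M) (U : set M) : open U -> U x0 ->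
  exists b : M -> R, [/\ smooth_fun b, forall x, 0 <= b x, 0 < b x0 &
    forall x, ~ U x -> b x = 0].
Proof.
move=> Uo Ux0; have [c ac x0c] := atlas_cover x0; have cC := atlas_chart ac.
pose y0 := chart_map c x0.
have y0c : chart_cod c y0 by exists x0.
have /nbhs_ballP[e /= e0 eW] : nbhs y0 (chart_cod c `&` chart_inv c @^-1` U).
  apply: open_nbhs_nbhs; split; first exact: open_chart_cod_preimage.
  by split=> //=; rewrite (chart_mapK cC).
pose w (y : 'rV[R]_n) i : R := (e / 2) ^+ 2 - (y 0 i - y0 0 i) ^+ 2.
pose beta y := \prod_i flat 0 (w y i).
have beta_ge0 y : 0 <= beta y by apply: prodr_ge0 => i _; exact: flat_ge0.
pose K : set 'rV[R]_n := [set y | forall i, `[y0 0 i - e / 2, y0 0 i + e / 2]%classic (y 0 i)].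
have betaK y : beta y != 0 -> K y.
  move=> /prodf_neq0 by0 i; have := by0 i isT.
  have [wi|wi _] := lerP (w y i) 0; first by rewrite flat_le0// eqxx.
  rewrite /= in_itv /= -ler_distl; apply: ltW.
  rewrite -ltr_sqr ?nnegrE ?divr_ge0 ?(ltW e0)//.
  by rewrite real_normK ?num_real// -subr_gt0.
have Kball : K `<=` ball y0 e.
  move=> y Ky; split=> // i j; rewrite (ord1 i) /ball /= distrC.
  have := Ky j; rewrite /= in_itv /= -ler_distl => /le_lt_trans; apply.
  by rewrite ltr_pdivrMr// mulr_natr mulr2n ltrDr.
have Kc : compact K.
  apply: (@rV_compact _ _ (fun i => `[y0 0 i - e / 2, y0 0 i + e / 2]%classic)) => i.
  exact: segment_compact.
pose K' := chart_inv c @` K.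
have K'c : closed K'.
  apply: compact_closed; first exact: manifold_hausdorff.
  apply: continuous_compact => //.
  apply: continuous_in_subspaceT => y /set_mem /Kball /eW[yc _].
  exact: chart_inv_continuous cC _ yc.
pose b x := if `[< chart_dom c x >] then beta (chart_map c x) else 0.
have bK x : b x != 0 -> K' x.
  rewrite /b; case: asboolP => [xc bx|_]; last by rewrite eqxx.
  by exists (chart_map c x); [exact: betaK|exact: chart_mapK cC _ xc].
exists b; split => [d ad r|x||x Ux].
- apply: Ck_on_local => y yd.
  have [xd mx] := chart_codP ad yd.
  have dC := atlas_chart ad.
  (* Inside the domain of c use the change of charts; outside it, the
     complement of the support. *)
  have [xc|xc] := pselect (chart_dom c (chart_inv d y)).
    exists (chart_cod d `&` chart_inv d @^-1` chart_dom c).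
    exists (fun y => beta (chart_map c (chart_inv d y))); split=> //.
    + apply: open_chart_cod_preimage => //; exact: chart_dom_open.
    + have Ao : open (chart_cod d `&` chart_inv d @^-1` chart_dom c).
        apply: open_chart_cod_preimage => //; exact: chart_dom_open.
      have T i : Ck_on r (chart_cod d `&` chart_inv d @^-1` chart_dom c)
        (fun y => flat 0 (w (chart_map c (chart_inv d y)) i)).
        apply: Ck_on_flat => //.
        have Cd : Ck_on r (chart_cod d `&` chart_inv d @^-1` chart_dom c)
            (fun y => chart_map c (chart_inv d y) 0 i + - y0 0 i).
          apply: Ck_onD => //; last exact: Ck_on_cst.
          apply: Ck_on_coord => //; apply: Ck_on_sub (atlas_smooth ad ac r).
          by move=> z [zd zc]; have [? ?] := chart_codP ad zd; exists (chart_inv d z).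
        rewrite /w; under eq_fun do rewrite -mulN1r expr2.
        apply: Ck_onD => //; first exact: Ck_on_cst.
        by apply: Ck_onM => //; [exact: Ck_on_cst|exact: Ck_onM].
      rewrite /beta; elim: (index_enum _) => [|i s IH].
        by under eq_fun do rewrite big_nil; exact: Ck_on_cst.
      by under eq_fun do rewrite big_cons; apply: Ck_onM.
    + by move=> z [_ /= zc]; rewrite /b asboolT.
  exists (chart_cod d `&` chart_inv d @^-1` (~` K')), (cst 0); split.
  + by apply: open_chart_cod_preimage => //; exact: closed_openC.
  + split=> //= -[z Kz zE]; apply: xc; rewrite -zE.
    by have [] := chart_codP ac (eW _ (Kball _ Kz)).1.
  + exact: Ck_on_cst.
  + by move=> z [_ /= zK]; apply/eqP; apply: contra_notT zK => /bK.
- by rewrite /b; case: ifP.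
- rewrite /b asboolT//; apply: prodr_gt0 => i _; apply: flat0_gt0.
  by rewrite /w subrr expr0n subr0 exprn_gt0 ?divr_gt0.
apply/eqP; apply: contra_notT Ux => /bK[y Ky <-].
exact: (eW _ (Kball _ Ky)).2.
Qed.

End SmoothFunctions.

(** * Smooth functions on a compact manifold *)

Section Compactness.
Context {R : realType}.

(** This replaces partitions of unity: a property stable under sums that holds
    near each point with a positive weight holds globally with a positive
    weight, by which one may then divide. *)
Lemma compact_positive_sum (T : topologicalType) (P : (T -> R) -> Prop) :
  compact [set: T] -> P (cst 0) ->
  (forall s t, P s -> P t -> P (fun x => s x + t x)) ->
  (forall s, P s -> continuous s /\ forall x, 0 <= s x) ->
  (forall x, exists2 s, P s & 0 < s x) ->
  exists2 s, P s & forall x, 0 < s x.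
Proof.
move=> cT P0 PD Pc Px.
have /choice[s Hs] : forall x, exists s, P s /\ 0 < s x.
  by move=> x; have [s] := Px x; exists s.
have [[x0 _]|T0] := pselect (exists x : T, True); last first.
  by exists (cst 0) => // x; case: T0; exists x.
(* The base point x0 gives access to compactness by open covers, a property of
   pointed spaces. *)
pose T' : ptopologicalType := HB.pack T (isPointed.Build T x0).
have : @cover_compact T' setT by rewrite -compact_cover.
move=> /(_ T setT (fun x => s x @^-1` [set r | 0 < r])).
case=> [x _|x _|D _ DT].
- apply: open_comp; last exact: open_gt.
  by move=> y _; exact: (Pc _ (Hs x).1).1.
- by exists x => //=; exact: (Hs x).2.
exists (fun y => \sum_(x <- D) s x y) => [|y].
  elim: (enum_fset D) => [|x r IH].
    by under eq_fun do rewrite big_nil.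
  by under eq_fun do rewrite big_cons; apply: PD => //; exact: (Hs x).1.
have s0 x : 0 <= s x y by exact: (Pc _ (Hs x).1).2.
rewrite lt0r sumr_ge0 ?andbT// psumr_neq0//; apply/hasP.
by have [x /= xD sxy] := DT y I; exists x.
Qed.

(** Every point is in the complement of A or of B, so bumps vanishing on A or on
    B have nonnegative sums b and a with a + b > 0; then h = a / (a + b). *)
Lemma smooth_urysohn (n : nat) (M : manifold R n) (A B : set M) :
  compact [set: M] -> closed A -> closed B -> A `&` B = set0 ->
  exists h : M -> R, [/\ smooth_fun h, forall x, 0 <= h x <= 1,
    forall x, A x -> h x = 1 & forall x, B x -> h x = 0].
Proof.
move=> cM cA cB AB.
pose Q (C : set M) (s : M -> R) :=
  [/\ smooth_fun s, forall x, 0 <= s x & forall x, C x -> s x = 0].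
have QD C s t : Q C s -> Q C t -> Q C (fun x => s x + t x).
  move=> [ss s0 sC] [st t0 tC]; split=> [|x|x Cx].
  - exact: smooth_funD.
  - by rewrite addr_ge0.
  - by rewrite sC ?tC// addr0.
have Q0 C : Q C (cst 0) by split=> //; exact: smooth_fun_cst.
have QP C x : closed C -> ~ C x -> exists2 s, Q C s & 0 < s x.
  move=> cC Cx; have [b [sb b0 bx bC]] := smooth_bump (closed_openC cC) Cx.
  by exists b => //; split=> // y Cy; apply: bC; exact.
have [] := @compact_positive_sum M (fun s => exists a b, [/\ Q B a, Q A b &
  s = fun x => a x + b x]) cM.
- by exists (cst 0), (cst 0); split=> //; apply/funext => x; rewrite addr0.
- move=> _ _ [a [b [Qa Qb ->]]] [a' [b' [Qa' Qb' ->]]].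
  exists (fun x => a x + a' x), (fun x => b x + b' x); split; [exact: QD..|].
  by apply/funext => x; rewrite addrACA.
- move=> _ [a [b [[sa a0 _] [sb b0 _] ->]]]; split=> [|x]; last by rewrite addr_ge0.
  exact/smooth_fun_continuous/smooth_funD.
- move=> x; have [Bx|Bx] := pselect (B x).
    have Ax : ~ A x by move=> Ax; have : set0 x by rewrite -AB.
    have [b Qb bx] := QP A x cA Ax.
    exists b => //; exists (cst 0), b; split=> //.
    by apply/funext => y; rewrite add0r.
  have [a Qa ax] := QP B x cB Bx.
  exists a => //; exists a, (cst 0); split=> //.
  by apply/funext => y; rewrite addr0.
move=> _ [a [b [[sa a0 aB] [sb b0 bA] ->]]] ab0.
exists (fun x => a x * (a x + b x)^-1); split=> [|x|x Ax|x Bx].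
- apply: smooth_funM => //; apply: smooth_funV; last exact: smooth_funD.
  by move=> x; rewrite lt0r_neq0.
- by rewrite divr_ge0 ?addr_ge0//= ler_pdivrMr// mul1r lerDl.
- by rewrite bA// addr0 divff// lt0r_neq0//; move: (ab0 x); rewrite bA// addr0.
- by rewrite aB// mul0r.
Qed.

End Compactness.

(** * Non-overlapping intervals *)

Section Intervals.
Context {R : realType}.

(** Cousin's lemma in the form of an induction principle for intervals: a
    property that is additive, and true of the small intervals around each
    point, is true of the whole interval. The supremum of the right ends that
    can be reached from a is itself reached and cannot be less than b. *)
Lemma cousin (P : R -> R -> Prop) (a b : R) : a <= b ->
  (forall x y z, a <= x -> x <= y -> y <= z -> z <= b ->
     P x y -> P y z -> P x z) ->
  (forall t, a <= t <= b -> exists2 d : R, 0 < d &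
     forall x y, a <= x -> x <= t -> t <= y -> y <= b -> y - x < d -> P x y) ->
  P a b.
Proof.
move=> ab Padd Ploc.
pose S := [set x | a <= x <= b /\ P a x].
have Sa : S a.
  have [|d d0 Pd] := Ploc a; first by rewrite lexx.
  by split; [rewrite lexx|apply: Pd => //; rewrite subrr].
have Sb : has_sup S by split; [exists a|exists b => x [/andP[]]].
pose s := sup S.
have as_ : a <= s by exact: ub_le_sup Sb.2 _ Sa.
have sb : s <= b by apply: sup_le_ub; [exists a|move=> x [/andP[]]].
have [|d d0 Pd] := Ploc s; first by rewrite as_.
have [x [/andP[ax xb] Pax] xs] : exists2 x, S x & s - d / 2 < x.
  by apply: sup_adherent => //; rewrite divr_gt0.
have xles : x <= s by apply: ub_le_sup Sb.2 _ _; split => //; rewrite ax.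
pose y := Num.min b (s + d / 4).
have sy : s <= y by rewrite le_min sb /=; lra.
have yb : y <= b by rewrite ge_min lexx.
have yd : y <= s + d / 4 by rewrite ge_min lexx orbT.
have Pay : P a y.
  apply: (Padd a x y) => //; first exact: le_trans sy.
  by apply: Pd => //; lra.
have Sy : S y by split => //; rewrite yb (le_trans as_).
have ys : y <= s by exact: ub_le_sup Sb.2 _ Sy.
have -> // : b = y.
rewrite /y; case: leP => //; rewrite /y in ys; move: ys; rewrite ge_min => /orP[|]; lra.
Qed.

(** The families of intervals that occur in the definition of absolute
    continuity. *)
Definition nonoverlapping (a b : R) m (s t : 'I_m -> R) :=
  (forall i, [/\ a <= s i, s i <= t i & t i <= b]) /\
  (forall i j, i != j -> t i <= s j \/ t j <= s i).

Lemma abs_continuousP (V : normedModType R) (a b : R) (f : R -> V) :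
  abs_continuous a b f <-> forall e : R, 0 < e -> exists2 d : R, 0 < d &
  forall m (s t : 'I_m -> R), nonoverlapping a b s t ->
    \sum_(i < m) (t i - s i) < d -> \sum_(i < m) `|f (t i) - f (s i)| < e.
Proof.
split=> H e /H[d d0 Hd]; exists d => // m s t; first by case; exact: Hd.
by move=> ? ?; exact: Hd.
Qed.

Lemma nonoverlapping_length_measure (a b : R) m (s t : 'I_m -> R) (O : set R) :
  nonoverlapping a b s t -> measurable O ->
  (forall i, `[s i, t i] `<=` O) ->
  ((\sum_(i < m) (t i - s i))%:E <= @lebesgue_measure R O)%E.
Proof.
move=> [st dis] mO stO.
pose F i := `]s i, t i]%classic.
have mF i : measurable (F i) by exact: measurable_itv.
have tF : trivIset setT F.
  apply/trivIsetP => i j _ _ ij; rewrite -subset0 => x [].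
  rewrite /F /= !in_itv /= => /andP[sx xt] /andP[sx' xt'].
  by have [|] := dis i j ij => ?; lra.
rewrite -sumEFin.
have -> : (\sum_(i < m) (t i - s i)%:E = \sum_(i < m) lebesgue_measure (F i))%E.
  apply: eq_bigr => i _; rewrite /F lebesgue_measure_itv /= lte_fin.
  have [_ sti _] := st i.
  case: ltP => // ?.
  have -> : t i = s i by apply/eqP; rewrite eq_le sti andbT.
  by rewrite subrr.
rewrite -(@measure_bigsetU_ord _ _ _ (@lebesgue_measure R) m predT F)//.
apply: le_measure; rewrite ?inE//.
  by apply: bigsetU_measurable => i _; exact: mF.
apply: (big_ind (fun A => A `<=` O)) => [//|A B AO BO|i _].
  by move=> x [/AO|/BO].
apply: subset_trans (stO i) => x; rewrite /F /= !in_itv /= => /andP[/ltW-> ->] //.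
Qed.

Definition cat_fam (T : Type) m1 m2 (s1 : 'I_m1 -> T) (s2 : 'I_m2 -> T)
  (i : 'I_(m1 + m2)) : T :=
  match fintype.split i with inl j => s1 j | inr j => s2 j end.

Lemma cat_fam_lshift T m1 m2 (s1 : 'I_m1 -> T) (s2 : 'I_m2 -> T) j :
  cat_fam s1 s2 (lshift m2 j) = s1 j.
Proof. by rewrite /cat_fam -[lshift _ _]/(unsplit (inl j)) unsplitK. Qed.

Lemma cat_fam_rshift T m1 m2 (s1 : 'I_m1 -> T) (s2 : 'I_m2 -> T) j :
  cat_fam s1 s2 (rshift m1 j) = s2 j.
Proof. by rewrite /cat_fam -[rshift _ _]/(unsplit (inr j)) unsplitK. Qed.

Lemma sum_cat_fam (F : R -> R -> R) m1 m2 (s1 t1 : 'I_m1 -> R)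
    (s2 t2 : 'I_m2 -> R) :
  \sum_i F (cat_fam s1 s2 i) (cat_fam t1 t2 i) =
  \sum_i F (s1 i) (t1 i) + \sum_i F (s2 i) (t2 i).
Proof.
rewrite big_split_ord /=; congr (_ + _); apply: eq_bigr => i _.
  by rewrite !cat_fam_lshift.
by rewrite !cat_fam_rshift.
Qed.

Lemma nonoverlapping_cat (x y z : R) m1 m2 (s1 t1 : 'I_m1 -> R)
    (s2 t2 : 'I_m2 -> R) : x <= y -> y <= z ->
  nonoverlapping x y s1 t1 -> nonoverlapping y z s2 t2 ->
  nonoverlapping x z (cat_fam s1 s2) (cat_fam t1 t2).
Proof.
move=> xy yz [H1 D1] [H2 D2]; split=> [i|i j].
  rewrite /cat_fam; case: (fintype.split i) => k.
    by have [? ? ?] := H1 k; split=> //; exact: le_trans yz.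
  by have [? ? ?] := H2 k; split=> //; exact: le_trans xy _.
rewrite -(splitK i) -(splitK j) (inj_eq (can_inj unsplitK)).
rewrite /cat_fam !unsplitK.
case: (fintype.split i) (fintype.split j) => k [] l kl.
- by apply: D1; apply: contraNneq kl => ->.
- by left; have [_ _ ?] := H1 k; have [? _ _] := H2 l; lra.
- by right; have [_ _ ?] := H1 l; have [? _ _] := H2 k; lra.
- by apply: D2; apply: contraNneq kl => ->.
Qed.

Lemma nonoverlapping1 (x y : R) : x <= y ->
  nonoverlapping x y (fun _ : 'I_1 => x) (fun=> y).
Proof.
by move=> xy; split=> [i|i j]; [split | rewrite !ord1 eqxx].
Qed.

Lemma nonoverlapping0 (x y : R) :
  nonoverlapping x y (fun _ : 'I_0 => x) (fun=> y).
Proof. by split=> [[]|[]]. Qed.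

Lemma is_derive_increment (u : R -> R) (t u' : R) : is_derive t (1 : R) u u' ->
  forall e : R, 0 < e -> exists2 d : R, 0 < d & forall s, `|s - t| < d ->
    `|u s - u t - u' * (s - t)| <= e * `|s - t|.
Proof.
move=> du e e0.
have : (fun h : R => h^-1 *: ((u \o shift t) (h *: (1 : R)) - u t)) @ 0^' --> u'.
  by rewrite -(@derive_val _ _ _ _ _ _ _ du); exact: ex_derive.
move/cvgrPdist_le => /(_ e e0); rewrite near_withinE => /nbhs_ballP[d /= d0 Hd].
exists d => // s; have [->|st sd] := eqVneq s t.
  by rewrite !subrr mulr0 subrr normr0 mulr0.
have st0 : s - t != 0 by rewrite subr_eq0.
have := Hd (s - t); rewrite /ball /= sub0r normrN => /(_ sd st0).
rewrite /= /GRing.scale /= mulr1 subrK => H.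
have -> : u s - u t - u' * (s - t) = - ((u' - (s - t)^-1 * (u s - u t)) * (s - t)).
  by field.
by rewrite normrN normrM ler_wpM2r.
Qed.

Lemma ae_null_set (P : R -> Prop) : {ae @lebesgue_measure R, forall t, P t} ->
  exists A : set R, [/\ measurable A, @lebesgue_measure R A = 0%E &
    forall t, ~ P t -> A t].
Proof. by case=> A [mA A0 PA]; exists A; split=> // t /PA. Qed.

(** Call A the null set where the derivatives are missing, O an open set that
    contains A and is so small that u varies by less than e/2 on families
    inside O. A short interval around a point of A lies in O; a short interval
    around another point satisfies |du| <= |dphi| + eta dt by the hypothesis on
    derivatives. By Cousin's lemma [a, b] is covered by intervals of these two
    kinds; the first contribute at most e/2, the second at most
    V + eta (b - a). The predicate Q below records two families, one of each
    kind, since only the existence of such families is additive. *)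
Lemma abs_continuous_growth (a b V : R) (u phi : R -> R) : a <= b ->
  abs_continuous a b u ->
  {ae @lebesgue_measure R, forall t, t \in `[a, b] -> exists u' phi' : R,
     [/\ is_derive t (1 : R) u u', is_derive t (1 : R) phi phi' &
         `|u'| <= `|phi'|]} ->
  (forall m (s t : 'I_m -> R), nonoverlapping a b s t ->
     \sum_i (t i - s i) <= b - a -> \sum_i `|phi (t i) - phi (s i)| <= V) ->
  `|u b - u a| <= V.
Proof.
move=> ab /abs_continuousP acu /ae_null_set[A [mA A0 NA]] Vphi.
apply/ler_addgt0Pr => e e0.
have [d d0 Hd] := acu (e / 2) (divr_gt0 e0 (ltr0Sn _ 1)).
have muA : (@lebesgue_measure R A < +oo)%E by rewrite A0 ltry.
have [ O [Oo AO Od]] : exists O : set R, [/\ open O, A `<=` O &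
    (@lebesgue_measure R (O `\` A) < d%:E)%E].
  exact: lebesgue_regularity_outer mA muA d0.
have mO : measurable O by exact: measurable_realfun.open_measurable.
have muO : (@lebesgue_measure R O < d%:E)%E.
  have mOA : measurable (O `\` A) by exact: measurableD.
  have : (@lebesgue_measure R O <= @lebesgue_measure R ((O `\` A) `|` A))%E.
    apply: le_measure; rewrite ?inE//; first exact: measurableU.
    by move=> x Ox; have [Ax|Ax] := pselect (A x); [right|left].
  have : (@lebesgue_measure R ((O `\` A) `|` A)
      <= @lebesgue_measure R (O `\` A) + @lebesgue_measure R A)%E.
    exact: measureU2.
  rewrite A0 adde0 => OA1 OA2.
  exact: le_lt_trans OA2 (le_lt_trans OA1 Od).
have [eta eta0 etaE] : exists2 eta : R, 0 < eta & eta * (b - a) <= e / 2.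
  have ba1 : 0 < b - a + 1 by lra.
  exists (e / 2 / (b - a + 1)); first by rewrite !divr_gt0.
  by rewrite mulrAC ler_pdivrMr// ler_wpM2l ?divr_ge0 ?(ltW e0)//; lra.
pose Q x y := exists m (s t : 'I_m -> R) m' (s' t' : 'I_m' -> R),
  [/\ nonoverlapping x y s t, (forall i, `[s i, t i] `<=` O),
      nonoverlapping x y s' t', \sum_i (t' i - s' i) <= y - x &
      `|u y - u x| <= \sum_i `|u (t i) - u (s i)|
         + \sum_i `|phi (t' i) - phi (s' i)| + eta * (y - x)].
have : Q a b.
  apply: cousin => // [x y z _ xy yz _|t tab].
    move=> [m1 [s1 [t1 [m1' [s1' [t1' [H1 O1 H1' l1 E1]]]]]]].
    move=> [m2 [s2 [t2 [m2' [s2' [t2' [H2 O2 H2' l2 E2]]]]]]].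
    exists (m1 + m2)%N, (cat_fam s1 s2), (cat_fam t1 t2).
    exists (m1' + m2')%N, (cat_fam s1' s2'), (cat_fam t1' t2').
    split; [exact: nonoverlapping_cat H1 H2| |exact: nonoverlapping_cat H1' H2'| |].
    - by move=> i; rewrite /cat_fam; case: (fintype.split i).
    - rewrite (sum_cat_fam (fun s t => t - s)); lra.
    - rewrite (sum_cat_fam (fun s t => `|u t - u s|)).
      rewrite (sum_cat_fam (fun s t => `|phi t - phi s|)).
      have -> : u z - u x = (u z - u y) + (u y - u x) by ring.
      apply: le_trans (ler_normD _ _) _; lra.
  have [At|At] := pselect (A t).
    have /nbhs_ballP[r /= r0 rO] : nbhs t O by apply: open_nbhs_nbhs; split=> //; exact: AO.
    exists r => // x y _ xt ty _ yxr; exists 1%N, (fun=> x), (fun=> y), 0%N, (fun=> x), (fun=> y).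
    have xy : x <= y by exact: le_trans ty.
    split; [exact: nonoverlapping1| |exact: nonoverlapping0| |].
    - move=> _ z /=; rewrite in_itv /= => /andP[xz zy]; apply: rO.
      by rewrite /ball /= ltr_norml; lra.
    - by rewrite big_ord0 subr_ge0.
    - by rewrite big_ord1 big_ord0 addr0 lerDl mulr_ge0 ?(ltW eta0) ?subr_ge0.
  have [u' [phi' [du dphi u'phi']]] : exists u' phi' : R,
     [/\ is_derive t (1 : R) u u', is_derive t (1 : R) phi phi' &
         `|u'| <= `|phi'|].
    by apply: contrapT => H; apply: At; apply: NA => /= /(_ _)/H; apply; rewrite in_itv.
  have eta20 : 0 < eta / 2 by rewrite divr_gt0.
  have [d1 d10 Hd1] := is_derive_increment du eta20.
  have [d2 d20 Hd2] := is_derive_increment dphi eta20.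
  exists (Num.min d1 d2) => [|x y _ xt ty _]; first by rewrite lt_min d10.
  rewrite lt_min => /andP[yx1 yx2].
  have xy : x <= y by exact: le_trans ty.
  exists 0%N, (fun=> x), (fun=> y), 1%N, (fun=> x), (fun=> y).
  split; [exact: nonoverlapping0|by case|exact: nonoverlapping1|by rewrite big_ord1|].
  rewrite big_ord0 add0r big_ord1.
  have tx : `|x - t| = t - x by rewrite ler0_norm ?subr_le0// opprB.
  have yt : `|y - t| = y - t by rewrite ger0_norm ?subr_ge0.
  have := Hd1 x; have := Hd1 y; have := Hd2 x; have := Hd2 y.
  rewrite !tx !yt => /(_ ltac:(lra)) P1 /(_ ltac:(lra)) P2 /(_ ltac:(lra)) P3 /(_ ltac:(lra)) P4.
  set U1 := u y - u t - _ in P3; set U2 := u x - u t - _ in P4.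
  set F1 := phi y - phi t - _ in P1; set F2 := phi x - phi t - _ in P2.
  have -> : u y - u x = (U1 - U2) + u' * (y - x) by rewrite /U1 /U2; ring.
  have -> : phi y - phi x = (F1 - F2) + phi' * (y - x) by rewrite /F1 /F2; ring.
  have T1 := ler_normD (U1 - U2) (u' * (y - x)).
  have T2 := ler_normB U1 U2.
  have T3 := lerB_normD (phi' * (y - x)) (F1 - F2).
  have T4 := ler_normB F1 F2.
  rewrite [phi' * _ + _]addrC in T3.
  have T5 : `|u' * (y - x)| <= `|phi' * (y - x)|.
    by rewrite !normrM ler_wpM2r.
  clearbody U1 U2 F1 F2; lra.
move=> [m [s [t [m' [s' [t' [H1 HO H2 l2 E]]]]]]].
have B1 : \sum_i `|u (t i) - u (s i)| < e / 2.
  apply: (Hd _ _ _ H1); rewrite -lte_fin.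
  exact: le_lt_trans (nonoverlapping_length_measure H1 mO HO) muO.
have B2 := Vphi _ _ _ H2 l2.
lra.
Qed.

End Intervals.

(** * Absolute continuity along curves *)

Section AbsContinuity.
Context {R : realType}.

(** Cut each interval of a family at y: its parts are [min s y, min t y] and
    [max s y, max t y], and f(min t y) + f(max t y) = f(t) + f(y). *)
Lemma abs_continuous_glue (x y z : R) (f : R -> R) : x <= y -> y <= z ->
  abs_continuous x y f -> abs_continuous y z f -> abs_continuous x z f.
Proof.
move=> xy yz /abs_continuousP H1 /abs_continuousP H2; apply/abs_continuousP => e e0.
have e20 : 0 < e / 2 by rewrite divr_gt0.
have [d1 d10 Hd1] := H1 _ e20; have [d2 d20 Hd2] := H2 _ e20.
exists (Num.min d1 d2) => [|m s t [st dis]]; first by rewrite lt_min d10.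
rewrite lt_min => /andP[l1 l2].
pose lo (u : 'I_m -> R) i := Num.min (u i) y.
pose hi (u : 'I_m -> R) i := Num.max (u i) y.
have lohi (u : 'I_m -> R) i : f (lo u i) + f (hi u i) = f (u i) + f y.
  by rewrite /lo /hi; case: (leP (u i) y) => // _; rewrite addrC.
have len (F : ('I_m -> R) -> 'I_m -> R) :
    (forall i, F t i - F s i <= t i - s i) ->
    \sum_i (F t i - F s i) <= \sum_i (t i - s i).
  by move=> H; apply: ler_sum.
have A1 : \sum_i `|f (lo t i) - f (lo s i)| < e / 2.
  apply: Hd1.
    split=> [i|i j ij]; have [x1 x2 x3] := st i; rewrite /lo.
      by split; rewrite ?le_min ?ge_min ?x1 ?x2 ?lexx ?orbT//.
    have [tij|tij] := dis i j ij; [left|right];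
    by rewrite le_min !ge_min tij lexx ?orbT.
  apply: le_lt_trans l1; apply: len => i; have [x1 x2 x3] := st i; rewrite /lo.
  by case: (leP (t i) y); case: (leP (s i) y) => *; lra.
have A2 : \sum_i `|f (hi t i) - f (hi s i)| < e / 2.
  apply: Hd2.
    split=> [i|i j ij]; have [x1 x2 x3] := st i; rewrite /hi.
      by split; rewrite ?ge_max ?le_max ?x3 ?x2 ?lexx ?orbT//.
    have [tij|tij] := dis i j ij; [left|right];
    by rewrite ge_max !le_max tij lexx ?orbT.
  apply: le_lt_trans l2; apply: len => i; have [x1 x2 x3] := st i; rewrite /hi.
  by case: (leP (t i) y); case: (leP (s i) y) => *; lra.
apply: (@le_lt_trans _ _ (\sum_i `|f (lo t i) - f (lo s i)| +
  \sum_i `|f (hi t i) - f (hi s i)|)); last lra.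
rewrite -big_split /=; apply: ler_sum => i _.
have -> : f (t i) - f (s i) =
  (f (lo t i) - f (lo s i)) + (f (hi t i) - f (hi s i)).
  have := lohi t i; have := lohi s i; lra.
exact: ler_normD.
Qed.

Lemma abs_continuous_sub (V : normedModType R) (a b a' b' : R) (f : R -> V) :
  a <= a' -> b' <= b -> abs_continuous a b f -> abs_continuous a' b' f.
Proof.
move=> aa bb H e /H[d d0 Hd]; exists d => // m s t st; apply: Hd => i.
by have [? ? ?] := st i; split; lra.
Qed.

Lemma abs_continuous_lipschitz (V W : normedModType R) (a b C : R)
    (f : R -> V) (h : R -> W) : 0 < C ->
  (forall s t, a <= s -> s <= t -> t <= b -> `|h t - h s| <= C * `|f t - f s|) ->
  abs_continuous a b f -> abs_continuous a b h.
Proof.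
move=> C0 hf H e e0; have [|d d0 Hd] := H (e / C); first exact: divr_gt0.
exists d => // m s t st dis /(Hd m s t st dis).
rewrite ltr_pdivlMr// mulr_suml; apply: le_lt_trans; apply: ler_sum => i _.
by have [? ? ?] := st i; rewrite mulrC; exact: hf.
Qed.

Lemma abs_continuousD (a b : R) (f h : R -> R) :
  abs_continuous a b f -> abs_continuous a b h ->
  abs_continuous a b (fun x => f x + h x).
Proof.
move=> H1 H2 e e0; have e20 : 0 < e / 2 by rewrite divr_gt0.
have [d1 d10 Hd1] := H1 _ e20; have [d2 d20 Hd2] := H2 _ e20.
exists (Num.min d1 d2) => [|m s t st dis]; first by rewrite lt_min d10.
rewrite lt_min => /andP[l1 l2].
apply: (@le_lt_trans _ _ (\sum_i `|f (t i) - f (s i)| +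
  \sum_i `|h (t i) - h (s i)|)).
  rewrite -big_split /=; apply: ler_sum => i _.
  by rewrite opprD addrACA; exact: ler_normD.
by have := Hd1 _ _ _ st dis l1; have := Hd2 _ _ _ st dis l2; lra.
Qed.

End AbsContinuity.

Section Lipschitz.
Context {R : realType} {n : nat}.

Lemma derive_coord_sum (F : 'rV[R]_n -> R) p v : differentiable F p ->
  'D_v F p = \sum_i v 0 i * 'D_(delta_mx 0 i) F p.
Proof.
move=> dF; rewrite deriveE// {1}(row_sum_delta v) linear_sum/=.
by apply: eq_bigr => i _; rewrite linearZ/= deriveE.
Qed.

(** Both derivatives are limits of literally the same difference quotients. *)
Lemma is_derive_line (F : 'rV[R]_n -> R) z v (t : R) :
  differentiable F (z + t *: v) ->
  is_derive t (1 : R) (fun s : R => F (z + s *: v)) ('D_v F (z + t *: v)).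
Proof.
move=> dF.
have E : (fun h : R => h^-1 *: (((fun s : R => F (z + s *: v)) \o shift t) (h *: (1 : R))
     - F (z + t *: v))) =
   (fun h : R => h^-1 *: ((F \o shift (z + t *: v)) (h *: v) - F (z + t *: v))).
  apply/funext => h /=; congr (_ *: (F _ - _)).
  by rewrite (_ : h *: (1 : R) = h) ?scalerDl 1?addrCA//; exact: mulr1.
have D := diff_derivable (v := v) dF.
by apply: DeriveDef; [rewrite /derivable E|rewrite /derive E].
Qed.

(** The partial derivatives are bounded near y0 by continuity, and balls are
    convex, so the mean value theorem applies along segments. *)
Lemma Ck1_locally_lipschitz (U : set 'rV[R]_n) (F : 'rV[R]_n -> R) y0 :
  open U -> Ck_on 1 U F -> U y0 ->
  exists2 r : R, 0 < r & exists2 C : R, 0 < C &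
    ball y0 r `<=` U /\
    forall y z, ball y0 r y -> ball y0 r z -> `|F y - F z| <= C * `|y - z|.
Proof.
move=> Uo [dF DF] Uy0.
pose B i := `|'D_(delta_mx 0 i) F y0| + 1.
have B0 i : 0 < B i by rewrite ltr_wpDl.
have NB i : \forall y \near y0, `|'D_(delta_mx 0 i) F y| <= B i.
  have /cvgrPdist_le/(_ _ ltr01) := DF (delta_mx 0 i) y0 Uy0.
  apply: filterS => y yd; rewrite /B -lerBlDl.
  by apply: le_trans (lerB_dist _ _) _; rewrite distrC.
have /nbhs_ballP[r /= r0 Hr] : \forall y \near y0, U y /\
    forall i, `|'D_(delta_mx 0 i) F y| <= B i.
  apply: filterI; first exact: open_nbhs_nbhs.
  exact: (filter_forall (nbhs_filter y0) NB).
(* The summand 1 keeps the constant positive in dimension 0. *)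
exists r => //; exists (\sum_i B i + 1); first by rewrite ltr_wpDl// sumr_ge0// => i _; rewrite ltW.
split=> [y /Hr[]//|y z yr zr].
pose p (t : R) := z + t *: (y - z).
have pr (t : R) : 0 <= t <= 1 -> ball y0 r (p t).
  move=> /andP[t0 t1]; move: yr zr; rewrite /p -!ball_normE /ball_ /= => yr zr.
  have -> : y0 - (z + t *: (y - z)) = (1 - t) *: (y0 - z) + t *: (y0 - y).
    by apply/rowP => i; rewrite !mxE; ring.
  apply: le_lt_trans (ler_normD _ _) _; rewrite !normrZ !ger0_norm ?subr_ge0//.
  have [->|tn0] := eqVneq t 0; first by rewrite subr0 mul1r mul0r addr0.
  have t_gt0 : 0 < t by rewrite lt_neqAle eq_sym tn0.
  have := ler_wpM2l (_ : 0 <= 1 - t) (ltW zr); rewrite subr_ge0 => /(_ t1).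
  have : t * `|y0 - y| < t * r by rewrite ltr_pM2l.
  lra.
have [||t] := @MVT_segment R (fun t => F (p t)) (fun t => 'D_(y - z) F (p t)) 0 1 ler01.
- move=> t; rewrite in_itv /= => /andP[t0 t1]; apply: is_derive_line.
  by apply: dF; have [] // := Hr (p t); apply: pr; rewrite !ltW.
- apply: continuous_in_subspaceT => t /set_mem /=; rewrite in_itv /= => t01.
  apply: differentiable_continuous; apply/derivable1_diffP.
  have := @is_derive_line F z (y - z) t; move=> H; apply: (@ex_derive _ _ _ _ _ _ _ (H _)).
  by apply: dF; have [] := Hr _ (pr _ t01).
rewrite in_itv /= => t01; have [Up Bp] := Hr _ (pr _ t01).
rewrite /p scale1r scale0r addr0 subr0 mulr1 [z + _]addrC subrK => ->.
rewrite derive_coord_sum; last exact: dF.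
apply: le_trans (ler_norm_sum _ _ _) _; rewrite mulrDl mul1r.
rewrite mulr_suml -[leLHS]addr0 lerD//.
apply: ler_sum => i _; rewrite normrM mulrC ler_pM//.
rewrite [leRHS]/Num.norm /= mx_normrE; apply/bigmax_geP; right => /=.
by exists (0, i).
Qed.

End Lipschitz.

Section Curve.
Context {R : realType} {n : nat} {M : manifold R n}.

(** The definition gives absolute continuity of the curve within a chart; there
    f is locally Lipschitz in the coordinates. Cousin's lemma glues the pieces. *)
Lemma abs_continuous_smooth_curve (f : M -> R) (p : R -> M) :
  smooth_fun f -> abs_continuous_curve p -> abs_continuous 0 1 (fun t => f (p t)).
Proof.
move=> sf [cp acp]; apply: (@cousin _ (fun x y => abs_continuous x y (fun t => f (p t)))) => //.
  by move=> x y z _ xy yz _; exact: abs_continuous_glue.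
move=> t t01; have [c ac tc] := atlas_cover (p t).
have cC := atlas_chart ac.
have yc : chart_cod c (chart_map c (p t)) by exists (p t).
have [r r0 [C C0 [rU HC]]] :=
  Ck1_locally_lipschitz (chart_cod_open cC) (sf c ac 1%N) yc.
have N : nbhs (p t) [set x | chart_dom c x /\ ball (chart_map c (p t)) r (chart_map c x)].
  apply: filterI; first by apply: open_nbhs_nbhs; split=> //; exact: chart_dom_open.
  by apply: (chart_map_continuous cC tc); exact: nbhsx_ballx.
move/subspace_continuousP : cp => /(_ t) /=; rewrite in_itv /= => /(_ t01) /(_ _ N) Nt.
have /nbhs_ballP[d /= d0 Hd] : nbhs t (fun s => `[0, 1]%classic s ->
    chart_dom c (p s) /\ ball (chart_map c (p t)) r (chart_map c (p s))) := Nt.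
have pd s : 0 <= s -> s <= 1 -> `|t - s| < d ->
    chart_dom c (p s) /\ ball (chart_map c (p t)) r (chart_map c (p s)).
  by move=> s0 s1 std; apply: Hd => //=; rewrite in_itv /= s0.
exists d => // x y x0 xt ty y1 yxd.
have Hxy s : x <= s -> s <= y -> chart_dom c (p s) /\
    ball (chart_map c (p t)) r (chart_map c (p s)).
  move=> xs sy; apply: pd; [lra|lra|rewrite ltr_norml; lra].
apply: (@abs_continuous_lipschitz _ _ _ _ _ _ (fun s => chart_map c (p s)) _ C0).
  move=> s u xs su uy.
  have [sd sr] := Hxy s xs (le_trans su uy).
  have [ud ur] := Hxy u (le_trans xs su) uy.
  by have := HC _ _ ur sr; rewrite !(chart_mapK cC).
by apply: acp => // s; rewrite in_itv /= => /andP[xs sy]; have [] := Hxy s xs sy.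
Qed.

End Curve.

(** * Tangent vectors and one-forms *)

Section Tangent.
Context {R : realType} {n : nat} {M : manifold R n}.

Lemma tangent0 (x : M) v : tangent x v -> v (cst 0) = 0.
Proof.
move=> tv; have s0 := @smooth_fun_cst R n M 0.
have := tangent_linear tv 1 s0 s0.
rewrite (_ : (fun y => _) = cst 0); last by apply/funext => y /=; rewrite mulr0 addr0.
lra.
Qed.

Lemma tangent_sum (x : M) v m (a : 'I_m -> R) (f : 'I_m -> M -> R) :
  tangent x v -> (forall i, smooth_fun (f i)) ->
  v (fun y => \sum_i a i * f i y) = \sum_i a i * v (f i).
Proof.
move=> tv sf; elim: m a f sf => [|m IH] a f sf.
  by rewrite big_ord0; under eq_fun do rewrite big_ord0; exact: tangent0 tv.
rewrite big_ord_recl /= -IH//.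
rewrite -(tangent_linear tv)//; last first.
  by apply: smooth_fun_sum => i; exact: smooth_funZ.
by congr v; apply/funext => y; rewrite big_ord_recl.
Qed.

Lemma lincomb0 (a : 'I_0 -> R) (v : 'I_0 -> tvec M) : lincomb a v = (fun=> 0).
Proof. by apply/funext => f; rewrite /lincomb big_ord0. Qed.

Lemma lincombS m (a : 'I_m.+1 -> R) (v : 'I_m.+1 -> tvec M) :
  lincomb a v = (fun f => a ord0 * v ord0 f +
    lincomb (fun i => a (lift ord0 i)) (fun i => v (lift ord0 i)) f).
Proof. by apply/funext => f; rewrite /lincomb big_ord_recl. Qed.

Lemma tangent_zero (x : M) : tangent x (fun=> 0).
Proof. by split=> *; rewrite ?mulr0 ?mul0r ?addr0. Qed.

Lemma tangent_lincomb (x : M) m (a : 'I_m -> R) (v : 'I_m -> tvec M) :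
  (forall i, tangent x (v i)) -> tangent x (lincomb a v).
Proof.
move=> tv; split=> [f sf|b f h sf sh|f h sf sh]; rewrite /lincomb.
- by rewrite big1// => i _; rewrite (tangent_junk (tv i) sf) mulr0.
- rewrite mulr_sumr -big_split; apply: eq_bigr => i _ /=.
  by rewrite (tangent_linear (tv i) b sf sh); ring.
- rewrite mulr_suml mulr_sumr -big_split; apply: eq_bigr => i _ /=.
  by rewrite (tangent_leibniz (tv i) sf sh); ring.
Qed.

Lemma one_form_zero (g : lieAlgebra R) (alpha : gform M g) (x : M) : one_form alpha ->
  alpha x (fun=> 0) = 0.
Proof.
move=> [al _]; have := al x 1 _ _ (tangent_zero x) (tangent_zero x).
rewrite (_ : (fun f => _) = (fun=> 0)); last by apply/funext => f; rewrite mulr0 addr0.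
by rewrite scale1r -[X in X = _]addr0 => /addrI.
Qed.

Lemma one_form_lincomb (g : lieAlgebra R) (alpha : gform M g) (x : M) m
    (a : 'I_m -> R) (v : 'I_m -> tvec M) : one_form alpha ->
  (forall i, tangent x (v i)) ->
  alpha x (lincomb a v) = \sum_i a i *: alpha x (v i).
Proof.
move=> oa; elim: m a v => [|m IH] a v tv.
  by rewrite lincomb0 big_ord0 one_form_zero.
rewrite lincombS big_ord_recl oa.1//; last exact: tangent_lincomb.
by rewrite IH.
Qed.

(** Two properties that hold for almost every t each provide a velocity; this
    lemma identifies them. It relies on tangent vectors being 0 on non-smooth
    functions, which makes them determined by their values on smooth ones. *)
Lemma velocity_unique (p : R -> M) t v w :
  velocity p t v -> velocity p t w -> v = w.
Proof.
move=> [tv dv] [tw dw]; apply/funext => f.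
have [sf|sf] := pselect (smooth_fun f); last by rewrite (tangent_junk tv) ?(tangent_junk tw).
by rewrite -(@derive_val _ _ _ _ _ _ _ (dv f sf)) (@derive_val _ _ _ _ _ _ _ (dw f sf)).
Qed.

End Tangent.

(** * Lie algebra valued functions *)

Section LieValued.
Context {R : realType} {n : nat} {M : manifold R n} {g : lieAlgebra R}.
Implicit Types (lam : {linear g -> R^o}) (F : M -> g).

Lemma lie_coord_sum (z : g) : z = \sum_i lie_coord i z *: (vbasis {:g})`_i.
Proof. by apply: coord_vbasis; exact: memvf. Qed.

Lemma functional_coord lam F x :
  lam (F x) = \sum_(i < \dim {:g}) (lam (vbasis {:g})`_i : R) * lie_coord i (F x).
Proof.
rewrite {1}[F x]lie_coord_sum linear_sum; apply: eq_bigr => i _.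
by rewrite linearZ /= mulrC.
Qed.

Lemma smooth_functional lam F : smooth_gfun F -> smooth_fun (fun x => lam (F x)).
Proof.
move=> sF; rewrite (funext (functional_coord lam F)).
by apply: smooth_fun_sum => i; exact: smooth_funZ.
Qed.

(** This reduces the derivative of a g-valued function to derivatives of real
    functions, so that membership in e can be tested on functionals. *)
Lemma gderiv_functional lam F x v : tangent x v -> smooth_gfun F ->
  lam (gderiv F v) = v (fun y => lam (F y)).
Proof.
move=> tv sF; rewrite (funext (functional_coord lam F)).
rewrite (tangent_sum _ tv)// /gderiv linear_sum; apply: eq_bigr => i _.
by rewrite linearZ /= mulrC.
Qed.

Lemma smooth_gfunZ (c : M -> R) (z : g) : smooth_fun c ->
  smooth_gfun (fun x => c x *: z).
Proof.
move=> sc i; rewrite (_ : (fun x => _) = (fun x => lie_coord i z * c x)).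
  exact: smooth_funZ.
by apply/funext => x; rewrite /lie_coord linearZ /= mulrC.
Qed.

Lemma lie_br0l (x : g) : lie_br 0 x = 0.
Proof.
have := lie_br_linearl 1 0 0 x; rewrite !scale1r addr0.
by rewrite -[X in X = _]addr0 => /addrI.
Qed.

(** Coordinates in a complement of e, taken after the projection along e: they
    cut out e, and the basis of the complement is dual to them. *)
Lemma dual_complement (e : {vspace g}) :
  exists (lam : 'I_(\dim e^C) -> {linear g -> R^o}) (z : 'I_(\dim e^C) -> g),
    (forall x, x \in e <-> forall i, lam i x = 0) /\
    (forall i j, lam i (z j) = (i == j)%:R).
Proof.
pose P := daddv_pi (e^C)%VS e.
have dis : (e^C :&: e = 0)%VS by rewrite capvC capv_compl.
exists (fun i => coord (vbasis (e^C)%VS) i \o P), (fun i => (vbasis (e^C)%VS)`_i).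
split=> [x|i j] /=; last first.
  rewrite /P daddv_pi_id//; last by rewrite vbasis_mem// mem_nth ?size_tuple.
  by rewrite coord_free 1?eq_sym// (basis_free (vbasisP _)).
have xP : x = P x + daddv_pi e (e^C)%VS x.
  rewrite /P daddv_pi_add// memvE; apply: subv_trans (subvf _) _.
  by rewrite addvC addv_complf.
have PC : P x \in (e^C)%VS by exact: memv_pi.
split=> [xe i|xi].
  suff -> : P x = 0 by rewrite linear0.
  apply/eqP; rewrite -memv0 -dis memv_cap PC/= -[P x](addrK (daddv_pi e (e^C)%VS x)) -xP.
  by rewrite rpredB// memv_pi.
rewrite xP [P x](coord_vbasis PC) big1 ?add0r ?memv_pi// => i _.
by rewrite [coord _ _ _]xi scale0r.
Qed.

End LieValued.

(** * Forms vanishing along a loop *)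

Section AlmostEverywhere.
Context {R : realType}.
Local Notation ae P := {ae @lebesgue_measure R, forall t : R, P t}.

Lemma ae_imply2 (P Q S : R -> Prop) : (forall t, P t -> Q t -> S t) ->
  ae P -> ae Q -> ae S.
Proof. exact: (@filterS2 _ _ (ae_filter_ringOfSetsType lebesgue_measure)). Qed.

Lemma ae_imply (P S : R -> Prop) : (forall t, P t -> S t) -> ae P -> ae S.
Proof. exact: (@filterS _ _ (ae_filter_ringOfSetsType lebesgue_measure)). Qed.

End AlmostEverywhere.

Section Singular.
Context {R : realType} {n : nat} {M : manifold R n} {g : lieAlgebra R}.

Lemma one_form_elementary (h f : M -> R) (z : g) : smooth_fun h -> smooth_fun f ->
  one_form (fun x (v : tvec M) => (h x * v f) *: z).
Proof.
move=> sh sf; split=> [x a u v tu tv|X [tX sX]].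
  by rewrite scalerA -scalerDl; congr (_ *: z); ring.
by apply: (@smooth_gfunZ _ _ _ _ (fun x => h x * X x f)); apply: smooth_funM => //; exact: sX.
Qed.

Lemma closed_curve_image (p : R -> M) a b : 0 <= a -> b <= 1 ->
  {within `[0, 1], continuous p} -> closed (p @` `[a, b]).
Proof.
move=> a0 b1 cp; apply: compact_closed; first exact: manifold_hausdorff.
apply: continuous_compact; last exact: segment_compact.
apply: continuous_subspaceW cp => t /=; rewrite !in_itv /= => /andP[? ?].
by apply/andP; split; lra.
Qed.

(** With u = lam(F(p)) and phi = f(p), one has u' = h(p) phi'. So u is constant
    on [0, a'] and on [b', 1], u - phi is constant on [a, b], and u varies by at
    most phi(a)/3 on each of [a', a] and [b, b'] because 0 <= h <= 1. As
    u(0) = u(1), this bounds phi(a) - phi(b) = phi(a) by two thirds of phi(a),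
    whereas phi(a) > 0. *)
Lemma singular_of_loop (D : M -> set (tvec M)) (e : {vspace g}) (alpha : gform M g)
    (p : R -> M) :
  compact [set: M] -> (\dim e < \dim {:g})%N ->
  horizontal D p -> non_intersecting_loop p ->
  {ae @lebesgue_measure R, forall t, t \in `[0, 1] ->
     exists2 v, velocity p t v & alpha (p t) v = 0} ->
  singular_form D e alpha.
Proof.
move=> cM de [acp aeD] [p01 inj] aeA reg; have [cp _] := acp.
have [lam0 [z0 [lame lamz]]] := dual_complement e.
have dC : (0 < \dim e^C)%N by rewrite dimv_compl subn_gt0.
pose lam := lam0 (Ordinal dC); pose z := z0 (Ordinal dC).
have lamz1 : lam z = 1 :> R by rewrite /lam lamz eqxx.
pose a : R := 1 / 3; pose b : R := 2 / 3.
have pab : p a <> p b.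
  by move/inj; rewrite !in_itv /= /a /b => H; have := H ltac:(lra) ltac:(lra); lra.
have opb : open (~` [set p b]).
  apply: closed_openC; apply: accessible_closed_set1.
  exact/hausdorff_accessible/manifold_hausdorff.
have [f [sf f0 fa fb]] := smooth_bump opb pab.
have fpb : f (p b) = 0 by apply: fb => /=; apply.
pose phi t := f (p t); have acphi := abs_continuous_smooth_curve sf acp.
have e0 : 0 < phi a / 3 by rewrite divr_gt0.
have [d d0 Hd] := acphi _ e0.
pose eta := Num.min (d / 2) (1 / 6).
have eta0 : 0 < eta by rewrite lt_min; lra.
have etad : eta < d by rewrite gt_min; apply/orP; left; lra.
have eta6 : eta <= 1 / 6 by rewrite ge_min lexx orbT.
clearbody eta; pose a' := a - eta; pose b' := b + eta.
have [h [sh h01 h1 h0]] : exists h : M -> R,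
   [/\ smooth_fun h, forall x, 0 <= h x <= 1,
     forall x, (p @` `[a, b]) x -> h x = 1 &
     forall x, (p @` `[0, a'] `|` p @` `[b', 1]) x -> h x = 0].
  apply: smooth_urysohn => //.
  - by apply: closed_curve_image => //; rewrite /a /b; lra.
  - by apply: closedU; apply: closed_curve_image => //; rewrite /a' /b' /a /b; lra.
  rewrite -subset0 => x [[s]] /=; rewrite in_itv /= => sab <-.
  have s01 : s \in `[0, 1[ by rewrite in_itv /=; rewrite /a /b in sab; lra.
  rewrite /a' /b' /a /b in sab *.
  case=> -[t] /=; rewrite in_itv /= => tab /esym pst.
    by have := inj s t s01 ltac:(rewrite in_itv /=; lra) pst; lra.
  (* Injectivity is known on [0, 1[ only; at t = 1 use p 1 = p 0. *)
  have [t1|t1] := eqVneq t 1.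
    by have := inj s 0 s01 ltac:(rewrite in_itv /=; lra) ltac:(rewrite p01 -t1//); lra.
  have t1' : t < 1 by rewrite lt_neqAle t1; lra.
  by have := inj s t s01 ltac:(rewrite in_itv /=; lra) pst; lra.
have [beta [F sF ->] HF] := reg _ (one_form_elementary z sh sf).
pose u t : R := lam (F (p t)).
have acu : abs_continuous 0 1 u.
  exact: abs_continuous_smooth_curve (smooth_functional lam sF) acp.
have ae' : {ae @lebesgue_measure R, forall t : R, t \in `[0, 1] -> exists phi' : R,
    is_derive t (1 : R) u (h (p t) * phi') /\ is_derive t (1 : R) phi phi'}.
  apply: ae_imply2 aeD aeA => t /= H1 H2 t01.
  have [v vp Dv] := H1 t01; have [w wp aw] := H2 t01.
  rewrite -(velocity_unique vp wp) in aw; have [tv dv] := vp.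
  exists (v f); split; last exact: dv.
  have := HF _ _ Dv; rewrite /= aw.
  rewrite lie_br0l addr0.
  move=> /lame/(_ (Ordinal dC)); rewrite -/lam linearB linearZ /= (gderiv_functional _ tv)//.
  rewrite lamz1 => /subr0_eq E.
  have := dv _ (smooth_functional lam sF).
  by rewrite E /GRing.scale /= mulr1.
have ac_sub x y (w : R -> R) : 0 <= x -> y <= 1 -> abs_continuous 0 1 w -> abs_continuous x y w.
  by move=> x0 y1; exact: abs_continuous_sub.
have const0 x y : 0 <= x -> x <= y -> y <= 1 ->
    (forall t, t \in `[x, y] -> h (p t) = 0) -> u y = u x.
  move=> x0 xy y1 hxy; apply/eqP; rewrite -subr_eq0 -normr_le0.
  apply: (@abs_continuous_growth _ x y 0 u (cst 0)) => //; first exact: ac_sub.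
    apply: ae_imply ae' => t H txy.
    have [|phi' [du _]] := H; first by move: txy; rewrite !in_itv /=; lra.
    exists 0, 0; split; [|exact: is_derive_cst|by rewrite normr0].
    by rewrite hxy// mul0r in du.
  by move=> m s t _ _; rewrite big1// => i _; rewrite subrr normr0.
have small x y : 0 <= x -> x <= y -> y <= 1 -> y - x < d ->
    `|u y - u x| <= phi a / 3.
  move=> x0 xy y1 yxd.
  apply: (@abs_continuous_growth _ x y _ u phi) => //; first exact: ac_sub.
    apply: ae_imply ae' => t H txy.
    have [|phi' [du dphi]] := H; first by move: txy; rewrite !in_itv /=; lra.
    exists (h (p t) * phi'), phi'; split => //.
    have /andP[hp0 hp1] := h01 (p t).
    by rewrite normrM ger0_norm// ler_piMl.
  move=> m s t [st dis] lst; apply: ltW; apply: Hd => // [i|].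
    by have [? ? ?] := st i; split; lra.
  lra.
have mid : (u b - phi b) = (u a - phi a).
  apply/eqP; rewrite -subr_eq0 -normr_le0.
  apply: (@abs_continuous_growth _ a b 0 (fun t => u t - phi t) (cst 0)) => //.
  - by rewrite /a /b; lra.
  - apply: abs_continuousD; apply: ac_sub => //; rewrite ?/a ?/b; [lra..|].
    apply: (abs_continuous_lipschitz ltr01 _ acphi) => s t _ _ _.
    by rewrite -opprD normrN mul1r.
  - apply: ae_imply ae' => t H txy.
    have [|phi' [du dphi]] := H; first by move: txy; rewrite !in_itv /= /a /b; lra.
    exists 0, 0; split; [|exact: is_derive_cst|by rewrite normr0].
    have -> : 0 = h (p t) * phi' - phi' by rewrite h1 ?mul1r ?subrr//; exists t.
    exact: is_deriveB.
  - by move=> m s t _ _; rewrite big1// => i _; rewrite subrr normr0.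
have u01 : u 1 = u 0 by rewrite /u p01.
have ua' : u a' = u 0.
  apply: const0; rewrite ?/a' ?/a//; [lra|lra|].
  by move=> t ta; apply: h0; left; exists t.
have ub' : u 1 = u b'.
  apply: const0; rewrite ?/b' ?/b//; [lra|lra|].
  by move=> t tb; apply: h0; right; exists t.
have := small a' a; have := small b b'.
rewrite /a' /b' /a /b => /(_ ltac:(lra) ltac:(lra) ltac:(lra) ltac:(lra)) S1.
move=> /(_ ltac:(lra) ltac:(lra) ltac:(lra) ltac:(lra)) S2.
rewrite -/a -/b -/a' -/b' in S1 S2.
have phib : phi b = 0 by exact: fpb.
move: S1 S2; rewrite !ler_norml; lra.
Qed.

End Singular.

(** * Matrices of smooth functions *)

Section SmoothMatrices.
Context {R : realType} {n : nat} {M : manifold R n}.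

Definition smooth_mx p q (A : M -> 'M[R]_(p, q)) : Prop :=
  forall i j, smooth_fun (fun x => A x i j).

Lemma smooth_mx_cst p q (A : 'M[R]_(p, q)) : smooth_mx (fun=> A).
Proof. by move=> i j; exact: smooth_fun_cst. Qed.

Lemma smooth_mxM p q r (A : M -> 'M[R]_(p, q)) (B : M -> 'M[R]_(q, r)) :
  smooth_mx A -> smooth_mx B -> smooth_mx (fun x => A x *m B x).
Proof.
move=> sA sB i j; rewrite (_ : (fun x => _) = (fun x => \sum_k A x i k * B x k j)).
  by apply: smooth_fun_sum => k; exact: smooth_funM.
by apply/funext => x; rewrite mxE.
Qed.

Lemma smooth_det p (A : M -> 'M[R]_p) :
  smooth_mx A -> smooth_fun (fun x => \det (A x)).
Proof.
move=> sA; apply: smooth_fun_sum => s; apply: smooth_funZ.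
exact: smooth_fun_prod.
Qed.

Lemma smooth_adj p (A : M -> 'M[R]_p) :
  smooth_mx A -> smooth_mx (fun x => \adj (A x)).
Proof.
move=> sA i j; rewrite (_ : (fun x => _) = (fun x =>
    (-1) ^+ (j + i) * \det (row' j (col' i (A x))))); last first.
  by apply/funext => x; rewrite mxE.
apply: smooth_funZ; apply: smooth_det => k l.
rewrite (_ : (fun x => _) = (fun x => A x (lift j k) (lift i l))); first exact: sA.
by apply/funext => x; rewrite !mxE.
Qed.

End SmoothMatrices.

Section Bracket.
Context {R : realType} {g : lieAlgebra R}.

(** The bracket as a linear map in its left argument. *)
Definition rbracket (b y : g) : g := lie_br y b.

HB.instance Definition _ (b : g) := GRing.isLinear.Build R g g _ (rbracket b)
  (fun a x y => lie_br_linearl a x y b).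

HB.instance Definition _ (y : g) := GRing.isLinear.Build R g g _ (lie_br y)
  (fun a x z => lie_br_linearr a y x z).

End Bracket.

(** * Forms injective on the subbundle *)

Section Regular.
Context {R : realType} {n : nat} {M : manifold R n} {g : lieAlgebra R}.
Context (k : nat) (D : M -> set (tvec M)) (e : {vspace g}) (alpha : gform M g)
  (oa : one_form alpha).

(** F = sum_j c_j B_j, for the basis B_j of e, solves the equation modulo e with
    right-hand side s psi. Carrying the weight s keeps the condition additive
    in the pair (s, c), and satisfied by 0. *)
Definition solves (psi : gform M g) (s : M -> R) (c : 'I_(\dim e) -> M -> R) :=
  forall x v, D x v ->
    lie_br (alpha x v) (\sum_j c j x *: (vbasis e)`_j) - s x *: psi x v \in e.

(** The frame of D is given by global vector fields, so the matrix T of the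
    linear system, with rows indexed by a basis of e and columns by pairs
    (frame vector, functional vanishing on e), is defined and smooth on all of
    M; only near x0 does it describe the condition on D. If S is such
    that S T(x0) = 1, and N = S T, then the row vector
    zeta adj(N) S solves the system with right-hand side det(N) zeta. The
    factor b, supported in the domain of the frame, makes the equation trivial
    where the frame does not span D, and the second factor det(N) makes the
    weight b det(N)^2 nonnegative. *)
Lemma local_solution (psi : gform M g) x0 : (1 <= k)%N ->
  subbundle k D -> form_in D e alpha -> strongly_bracket_generating k e ->
  form_injective_on D alpha -> one_form psi ->
  exists s c, [/\ smooth_fun s, forall x, 0 <= s x, 0 < s x0,
    forall j, smooth_fun (c j) & solves psi s c].
Proof.
move=> k1 sD ae sbg inj opsi.
have [U [Uo Ux0] [X sX XD]] := sD x0.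
have tX i x : tangent x (X i x) by exact: (sX i).1.
have [lam [z [lame lamz]]] := dual_complement e.
set r := \dim e^C in lam z lame lamz; set m := \dim e.
pose B j : g := (vbasis e)`_j.
pose A i x := alpha x (X i x); pose Z i x := psi x (X i x).
pose T x : 'M[R]_(m, k * r) := \matrix_j
  mxvec (\matrix_(i < k, l < r) (lam l (lie_br (A i x) (B j)) : R)).
pose zeta x : 'rV[R]_(k * r) := mxvec (\matrix_(i < k, l < r) (lam l (Z i x) : R)).
have TE x (c : 'rV_m) i l : (c *m T x) 0 (mxvec_index i l) =
    lam l (lie_br (A i x) (\sum_j c 0 j *: B j)) :> R.
  rewrite mxE !linear_sum; apply: eq_bigr => j _.
  by rewrite !mxE mxvecE mxE !linearZ.
have sT : smooth_mx T.
  move=> j q; case/mxvec_indexP: q => i l.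
  rewrite (_ : (fun x => _) = (fun x => (lam l \o rbracket (B j)) (A i x))).
    apply: smooth_functional; exact: (oa.2 _ (sX i)).
  by apply/funext => x; rewrite mxE mxvecE mxE.
have szeta : smooth_mx zeta.
  move=> j q; case/mxvec_indexP: q => i l.
  rewrite (_ : (fun x => _) = (fun x => lam l (Z i x))).
    apply: smooth_functional; exact: (opsi.2 _ (sX i)).
  by apply/funext => x; rewrite (ord1 j) mxvecE mxE.
have [S ST] : exists S, S *m T x0 = 1%:M.
  apply/row_fullP; rewrite -sub1mx; apply/row_subP => q.
  move: (row q _) => w; rewrite -[w]vec_mxK; move: (vec_mx w) => W {w}.
  pose At := [tuple A i x0 | i < k].
  pose Zt := [tuple \sum_l W i l *: z l | i < k].
  have kk : (1 <= k <= k)%N by rewrite k1 leqnn.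
  (* Surjectivity of the system at x0: any prescribed values W of the
     functionals are attained by the bracket with some element of e. *)
  have [|i|b be Hb] := sbg k kk At Zt.
  - apply/freeP => a a0 i; have [lin _] := XD x0 Ux0; apply: (lin a).
    have D0 : D x0 (fun=> 0).
      apply: ((XD x0 Ux0).2 _).2; exists (fun=> 0); apply/funext => f.
      by rewrite /lincomb big1// => j _; rewrite mul0r.
    have DX : D x0 (lincomb a (fun i => X i x0)) by apply: ((XD x0 Ux0).2 _).2; exists a.
    apply: inj DX D0 _; rewrite one_form_zero// one_form_lincomb//.
    by rewrite -[RHS]a0; apply: eq_bigr => j _; rewrite -tnth_nth tnth_mktuple.
  - rewrite tnth_mktuple; apply: ae; apply: ((XD x0 Ux0).2 _).2.
    exists (fun j => (j == i)%:R); apply/funext => f.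
    rewrite /lincomb (bigD1 i)//= eqxx mul1r big1 ?addr0// => j ji.
    by rewrite (negbTE ji) mul0r.
  apply/submxP; exists (\row_j coord (vbasis e) j b).
  apply/rowP => q'; case/mxvec_indexP: q' => i l; rewrite TE mxvecE.
  have <- : b = \sum_j (\row_j coord (vbasis e) j b) 0 j *: B j.
    by rewrite {1}(coord_vbasis be); apply: eq_bigr => j _; rewrite mxE.
  have /lame/(_ l) := Hb i; rewrite !tnth_mktuple linearB => /subr0_eq <-.
  rewrite linear_sum (bigD1 l)//= big1 => [|l' l'l]; rewrite linearZ /= lamz.
    by rewrite eqxx addr0 -[LHS]mulr1.
  by rewrite eq_sym (negbTE l'l) /GRing.scale /= mulr0.
pose N x := S *m T x; pose d x := \det (N x).
have sN : smooth_mx N by apply: smooth_mxM => //; exact: smooth_mx_cst.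
have sd : smooth_fun d by exact: smooth_det.
pose cc x := zeta x *m \adj (N x) *m S.
have scc : smooth_mx cc.
  apply: smooth_mxM; last exact: smooth_mx_cst.
  by apply: smooth_mxM => //; exact: smooth_adj.
have ccT x : cc x *m T x = d x *: zeta x.
  by rewrite /cc -mulmxA -/(N x) -mulmxA mul_adj_mx mul_mx_scalar.
have [b [sb b0 bx0 bU]] := smooth_bump Uo Ux0.
exists (fun x => b x * (d x * d x)), (fun j x => (b x * d x) * cc x 0 j).
split.
- by apply: smooth_funM => //; exact: smooth_funM.
- by move=> x; rewrite mulr_ge0// -expr2 sqr_ge0.
- by rewrite /d /N ST det1 !mulr1.
- by move=> j; apply: smooth_funM => //; exact: smooth_funM.
move=> x v Dv; rewrite (eq_bigr (fun j => (b x * d x) *: (cc x 0 j *: B j))); last first.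
  by move=> j _; rewrite scalerA.
rewrite -scaler_sumr linearZ /=.
rewrite (_ : b x * (d x * d x) = (b x * d x) * d x); last by rewrite mulrA.
rewrite -scalerA -scalerBr.
have [Ux|Ux] := pselect (U x); last by rewrite bU// mul0r scale0r mem0v.
apply: rpredZ.
have [w ->] := ((XD x Ux).2 v).1 Dv.
rewrite !one_form_lincomb//.
set Y := \sum_(j < m) cc x 0 j *: B j.
rewrite -/(rbracket Y _) linear_sum scaler_sumr -sumrB; apply: rpred_sum => i _.
rewrite linearZ /= scalerA mulrC -scalerA -scalerBr; apply: rpredZ.
apply/lame => l; rewrite linearB linearZ /= /rbracket.
have := congr1 (fun w : 'rV[R]_(k * r) => w 0 (mxvec_index i l)) (ccT x).
by rewrite TE mxE mxvecE mxE => ->; rewrite subrr.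
Qed.

(** The functional lam i annihilates F, which takes values in e, hence also dF;
    this leaves the bracket equation, in which the total weight s can be
    divided out. *)
Lemma regular_of_strongly_generating : (1 <= k)%N -> compact [set: M] ->
  subbundle k D -> form_in D e alpha -> strongly_bracket_generating k e ->
  form_injective_on D alpha -> regular_form D e alpha.
Proof.
move=> k1 cM sD ae sbg inj psi opsi.
have [||||s [ss [s0 [c sc Hc]]] s_gt0] := @compact_positive_sum R M (fun s => smooth_fun s /\
  (forall x, 0 <= s x) /\ exists2 c, forall j, smooth_fun (c j) & solves psi s c) cM.
- split; first exact: smooth_fun_cst.
  split=> //; exists (fun _ => cst 0) => [j|x v Dv]; first exact: smooth_fun_cst.
  rewrite big1 => [|j _]; last by rewrite scale0r.
  by rewrite linear0 scale0r subrr mem0v.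
- move=> s t [ss [s0 [c sc Hc]]] [st [t0 [c' sc' Hc']]].
  split; first exact: smooth_funD.
  split=> [x|]; first by rewrite addr_ge0.
  exists (fun j x => c j x + c' j x) => [j|x v Dv]; first exact: smooth_funD.
  under eq_bigr do rewrite scalerDl.
  rewrite big_split linearD /= scalerDl opprD addrACA.
  by apply: rpredD; [exact: Hc|exact: Hc'].
- by move=> s [ss [s0 _]]; split=> //; exact: smooth_fun_continuous.
- move=> x; have [s [c [ss s0 sx sc Hc]]] :=
    local_solution x k1 sD ae sbg inj opsi.
  by exists s => //; split=> //; split=> //; exists c.
have sn0 x : s x != 0 by rewrite gt_eqF.
pose c' j x := c j x * (s x)^-1.
have sc' j : smooth_fun (c' j).
  by apply: smooth_funM => //; exact: smooth_funV.
pose F x := \sum_j c' j x *: (vbasis e)`_j.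
have sF : smooth_gfun F.
  move=> i; rewrite (_ : (fun x => _) =
      (fun x => \sum_(j < \dim e) lie_coord i (vbasis e)`_j * c' j x)).
    by apply: smooth_fun_sum => j; exact: smooth_funZ.
  apply/funext => x; rewrite /F /lie_coord linear_sum; apply: eq_bigr => j _.
  by rewrite linearZ /= mulrC.
have [lam [z [lame _]]] := dual_complement e.
exists (fun x v => gderiv F v + lie_br (alpha x v) (F x)); first by exists F.
move=> x v Dv; rewrite -addrA; apply: rpredD.
  apply/lame => i; have tv : tangent x v.
    have [U [Uo Ux0] [X sX XD]] := sD x.
    have [a ->] := ((XD x Ux0).2 v).1 Dv.
    by apply: tangent_lincomb => j; exact: (sX j).1.
  rewrite (gderiv_functional _ tv sF) -[RHS](tangent0 tv); congr v.
  apply/funext => y; apply: (lame _).1; apply: rpred_sum => j _.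
  by apply/rpredZ/vbasis_mem/mem_nth; rewrite size_tuple.
rewrite /F (eq_bigr (fun j => (s x)^-1 *: (c j x *: (vbasis e)`_j))); last first.
  by move=> j _; rewrite scalerA mulrC.
rewrite -scaler_sumr linearZ /= -[psi x v]scale1r -(mulVf (sn0 x)) -scalerA -scalerBr.
by apply: rpredZ; exact: Hc.
Qed.

End Regular.

Theorem proposition3p7 (R : realType) (n k : nat) (M : manifold R n)
  (D : M -> set (tvec M)) (q : M -> tvec M -> tvec M -> R)
  (g : lieAlgebra R) (e : {vspace g}) (alpha : gform M g) :
  sub_riemannian k D q ->
  simply_connected R M ->
  compact [set: M] ->
  (2 <= k)%N ->
  lie_generating e ->
  (\dim e < \dim {:g})%N ->
  flat_form alpha ->
  form_in D e alpha ->
  ((exists p : R -> M,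
      [/\ horizontal D p,
          non_intersecting_loop p &
          {ae @lebesgue_measure R, forall t, t \in `[0, 1] ->
             exists2 v, velocity p t v & alpha (p t) v = 0}]) ->
   singular_form D e alpha) /\
  (strongly_bracket_generating k e ->
   form_injective_on D alpha ->
   regular_form D e alpha).
Proof.
move=> [_ sD _ _] _ cM k2 _ de [oa _] ae; split=> [[p [hp lp ap]]|].
  exact: singular_of_loop cM de hp lp ap.
exact: regular_of_strongly_generating oa (ltnW k2) cM sD ae.
Qed.
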